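(* There exists an absolute constant $c>0$ such that the following holds. Let $\rho=\rho(n)=1-\delta(n)$ satisfy $\rho(n)\cdot n^{1/3}\to\infty$ as $n\to\infty$. There is an $O(n)$-time algorithm $A$ which is given as input the values $n,\delta$ and a single trace $y\sim\mathrm{Del}_\delta(x)$, where $x\in\{0,1\}^n$ is an arbitrary unknown source string, such that with probability at least $1-e^{-\Omega(\rho^3 n)}$ over the randomness of $y\sim\mathrm{Del}_\delta(x)$, $A$ outputs a string $\hat{x}\in\{0,1\}^n$ satisfying $|\mathsf{LCS}(\hat{x},x)|\ge (2/3+c\rho)\,n$. (Here $\Omega(\cdot)$ hides an absolute constant.)
   Context: For $x\in\{0,1\}^n$ and $0<\delta<1$, the deletion channel $\mathrm{Del}_\delta(x)$ is the distribution over $\{0,1\}^{\le n}$ obtained by independently deleting each bit of $x$ with probability $\delta$ and concatenating the surviving bits; a draw from it is a trace of $x$. $|\mathsf{LCS}(u,v)|$ denotes the length of a longest common subsequence of strings $u,v$. *)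

(* Defs.v *)
From HB Require Import structures.
From mathcomp Require Import all_boot all_order all_algebra.
From mathcomp Require Import all_classical all_reals all_analysis.

Set Implicit Arguments.
Unset Strict Implicit.
Unset Printing Implicit Defensive.

Import Order.TTheory GRing.Theory Num.Theory.
Import numFieldNormedType.Exports.

Local Open Scope ring_scope.

(* A common subsequence of u and v has length at most size u, so the finite
   type of bounded sequences below contains all of them. *)
Definition LCS (u v : seq bool) : nat :=
  (\max_(w : (size u).-bseq bool | subseq w u && subseq w v) size w)%N.

(* The mask m records which bits of x survive (true = kept). *)
Definition del_pmf (R : realType) (n : nat) (delta : R) (x : n.-tuple bool)
    (y : n.-bseq bool) : R :=
  \sum_(m : n.-tuple bool | mask m x == y :> seq bool)
     \prod_(i < n) (if tnth m i then 1 - delta else delta).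

Definition del_prob (R : realType) (n : nat) (delta : R) (x : n.-tuple bool)
    (E : pred (n.-bseq bool)) : R :=
  \sum_(y : n.-bseq bool | E y) del_pmf delta x y.

(* Model of computation: structured programs for a random access machine with
   words of O(log n) bits. There are finitely many named registers (those that
   occur in the program), a random access memory, and a read-only input
   consisting of n, the length of the trace and the bits of the trace.
   The input delta is a real number, which does not fit in a word: it is read
   by exact comparisons with rationals p / q for words p and q. *)
Inductive expr : Type :=
| EConst of nat
| EReg of nat
| EMem of expr
| EN
| ELen
| EIn of expr
| EAdd of expr & expr
| ESub of expr & expr
| EMul of expr & expr
| EDiv of expr & expr.

Inductive cond : Type :=
| CLt of expr & expr
| CDelta of expr & expr
| CNot of cond
| CAnd of cond & cond.

Inductive cmd : Type :=
| Skip
| SetReg of nat & expr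
| SetMem of expr & expr
| Seq of cmd & cmd
| If of cond & cmd & cmd
| While of cond & cmd.

Record state : Type := State { reg : nat -> nat ; mem : nat -> nat }.

Definition init_state : state := State (fun=> 0%N) (fun=> 0%N).

Definition upd (f : nat -> nat) (i v : nat) : nat -> nat :=
  fun j => if j == i then v else f j.

Section Semantics.
Variables (R : realType) (n : nat) (delta : R) (y : seq bool).

Fixpoint eval (s : state) (e : expr) : nat :=
  match e with
  | EConst k => k
  | EReg r => reg s r
  | EMem a => mem s (eval s a)
  | EN => n
  | ELen => size y
  | EIn a => nth false y (eval s a)
  | EAdd a b => (eval s a + eval s b)%N
  | ESub a b => (eval s a - eval s b)%N
  | EMul a b => (eval s a * eval s b)%N
  | EDiv a b => (eval s a %/ eval s b)%N
  end.

(* CDelta p q tests delta < p / q. *)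
Fixpoint test (s : state) (b : cond) : bool :=
  match b with
  | CLt e1 e2 => (eval s e1 < eval s e2)%N
  | CDelta p q => delta * (eval s q)%:R < (eval s p)%:R
  | CNot b1 => ~~ test s b1
  | CAnd b1 b2 => test s b1 && test s b2
  end.

(* exec B c s s' t: started in state s, c halts in state s' after t steps,
   and every word it writes is smaller than B; there is no execution that
   writes a larger value. Evaluating an expression or a test takes a number of
   machine operations that depends on the program only, so counting one step
   for each assignment and each test is accurate up to a constant factor. *)
Inductive exec (B : nat) : cmd -> state -> state -> nat -> Prop :=
| exec_Skip s : exec B Skip s s 1
| exec_SetReg r e s :
    (eval s e < B)%N ->
    exec B (SetReg r e) s (State (upd (reg s) r (eval s e)) (mem s)) 1
| exec_SetMem a e s :
    (eval s e < B)%N ->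
    exec B (SetMem a e) s (State (reg s) (upd (mem s) (eval s a) (eval s e))) 1
| exec_Seq c1 c2 s s1 s2 t1 t2 :
    exec B c1 s s1 t1 -> exec B c2 s1 s2 t2 ->
    exec B (Seq c1 c2) s s2 (t1 + t2)
| exec_IfTrue b c1 c2 s s1 t :
    test s b -> exec B c1 s s1 t -> exec B (If b c1 c2) s s1 t.+1
| exec_IfFalse b c1 c2 s s1 t :
    ~~ test s b -> exec B c2 s s1 t -> exec B (If b c1 c2) s s1 t.+1
| exec_WhileFalse b c s :
    ~~ test s b -> exec B (While b c) s s 1
| exec_WhileTrue b c s s1 s2 t1 t2 :
    test s b -> exec B c s s1 t1 -> exec B (While b c) s1 s2 t2 ->
    exec B (While b c) s s2 (t1 + t2).+1.

End Semantics.

(* The output is the content of the memory cells 0, ..., n - 1. *)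
Definition output (n : nat) (s : state) : n.-tuple bool :=
  [tuple mem s i != 0%N | i < n].

(* A single program, with words of at most k * log2 (n + 2) bits, computes A
   on every input (n, delta, y) in O(n) steps. *)
Definition linear_time (R : realType)
    (A : forall n : nat, R -> n.-bseq bool -> n.-tuple bool) : Prop :=
  exists (prog : cmd) (k K : nat),
    forall (n : nat) (delta : R) (y : n.-bseq bool), 0 < delta < 1 ->
      exists (s : state) (t : nat),
        [/\ exec n delta y (n.+2 ^ k)%N prog init_state s t,
            (t <= K * n.+1)%N & output n s = A n delta y].

(* Main.v *)
(* One third of the output is devoted to a constant string and two thirds to an
   alternating one: b^(n/3) matches half of two thirds of x when b is the
   majority bit there, and the alternating string of length 2n/3 matches the
   remaining third completely. This gives 2n/3 for every x, and b can be read
   off the trace up to an error of order rho n, with failure probability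
   exp(-Omega(rho^3 n)).

   To gain order rho n more, look at the number of alternations of the trace of
   the first third. A string z with a alternations already embeds into an
   alternating string of length 2|z| - a. Since alternations of the trace are
   alternations of x, order rho n of them shorten the alternating part by as
   much, and the room is given to both parts of x in the right proportion. If
   there are fewer, cut the beginning of x into blocks of length of order
   1 / rho. Few blocks have a nonconstant trace, so most blocks are nearly
   constant, and repeating each letter of the trace about 1 / rho times recovers
   the first quarter of x with a small relative error; the rest of x is treated
   by the first strategy. *)
Require Import Defs.
From HB Require Import structures.
From mathcomp Require Import all_boot all_order all_algebra.
From mathcomp Require Import all_classical all_reals all_analysis.
From mathcomp Require Import zify ring lra.

Set Implicit Arguments.
Unset Strict Implicit.
Unset Printing Implicit Defensive.

Import Order.TTheory GRing.Theory Num.Theory.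
Import numFieldNormedType.Exports.

Local Open Scope classical_set_scope.
Local Open Scope ring_scope.

(** * Common subsequences *)

(** A lower bound instead of the maximum, so that bounds add up under concatenation and survive
    enlarging either string. *)
Definition common_subseq (u v : seq bool) (k : nat) : Prop :=
  exists w, [/\ subseq w u, subseq w v & (k <= size w)%N].

Lemma LCS_ge (u v : seq bool) (k : nat) : common_subseq u v k -> (k <= LCS u v)%N.
Proof.
case=> w [wu wv kw]; apply: leq_trans kw _; rewrite /LCS.
have szw : (size w <= size u)%N by exact: size_subseq.
by apply: (leq_bigmax_cond (Bseq szw)); rewrite /= wu wv.
Qed.

Lemma common_subseq_cat u1 v1 k1 u2 v2 k2 :
  common_subseq u1 v1 k1 -> common_subseq u2 v2 k2 ->
  common_subseq (u1 ++ u2) (v1 ++ v2) (k1 + k2).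
Proof.
move=> [w1 [wu1 wv1 kw1]] [w2 [wu2 wv2 kw2]].
by exists (w1 ++ w2); rewrite !cat_subseq // size_cat leq_add.
Qed.

Lemma common_subseqW u v k u' v' k' :
  subseq u u' -> subseq v v' -> (k' <= k)%N ->
  common_subseq u v k -> common_subseq u' v' k'.
Proof.
move=> uu vv kk [w [wu wv kw]]; exists w; split.
- exact: subseq_trans wu uu.
- exact: subseq_trans wv vv.
- exact: leq_trans kk kw.
Qed.

Lemma common_subseq0 u v : common_subseq u v 0.
Proof. by exists [::]; rewrite !sub0seq. Qed.

Lemma common_subseq_sub u v : subseq v u -> common_subseq u v (size v).
Proof. by exists v. Qed.

Lemma subseq_nseq_count (b : bool) (v : seq bool) :
  subseq (nseq (count_mem b v) b) v.
Proof.
elim: v => // a v IH; rewrite [count_mem b _]/=; case: eqVneq => [->|_].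
  by rewrite /= eqxx.
exact: subseq_trans IH (subseq_cons v a).
Qed.

Lemma subseq_nseq (b : bool) (p q : nat) : (p <= q)%N -> subseq (nseq p b) (nseq q b).
Proof.
by move=> pq; rewrite -(subnKC pq) nseqD prefix_subseq.
Qed.

Lemma common_subseq_nseq (b : bool) (u : nat) (v : seq bool) :
  common_subseq (nseq u b) v (minn u (count_mem b v)).
Proof.
exists (nseq (minn u (count_mem b v)) b); rewrite size_nseq leqnn; split => //.
  by apply: subseq_nseq; rewrite geq_minl.
by apply: subseq_trans (subseq_nseq_count b v); apply/subseq_nseq/geq_minr.
Qed.

(** * Alternations and embeddings into alternating strings *)

Fixpoint alts_from (a : bool) (s : seq bool) : nat :=
  if s is b :: s' then ((a != b) + alts_from b s')%N else 0.

(* The number of runs minus one. *)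
Definition alts (s : seq bool) : nat := if s is a :: s' then alts_from a s' else 0.

Lemma alts_from_cons a s : (alts s <= alts_from a s)%N.
Proof. by case: s => //= b s; rewrite leq_addl. Qed.

Lemma alts_from_flip a b s : (alts_from a s <= (a != b) + alts_from b s)%N.
Proof. by case: s => [|c s] //=; case: a b c => [] [] [] /=; lia. Qed.

(** Skipping a letter of [t] replaces two comparisons by one; [alts_from_flip] is the triangle
    inequality for them. *)
Lemma alts_from_subseq a s t : subseq s t -> (alts_from a s <= alts_from a t)%N.
Proof.
elim: t a s => [|c t IH] a s; first by move/eqP=> ->.
case: s => [|b s] //; have [<-|nbc] := eqVneq c b => /=.
  by rewrite eqxx => /(IH c) h; rewrite leq_add2l.
rewrite eq_sym (negPf nbc) => /(IH c) h.
by apply: leq_trans (alts_from_flip a c (b :: s)) _; rewrite leq_add2l.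
Qed.

Lemma alts_subseq s t : subseq s t -> (alts s <= alts t)%N.
Proof.
elim: t s => [|c t IH] s; first by move/eqP=> ->.
case: s => [|b s] //; have [<-|nbc] := eqVneq c b => /=.
  by rewrite eqxx; exact: alts_from_subseq.
rewrite eq_sym (negPf nbc) => /IH h.
exact: leq_trans h (alts_from_cons c t).
Qed.

Lemma alts_from_cat a s t : (alts_from a s + alts t <= alts_from a (s ++ t))%N.
Proof.
elim: s a => [|b s IH] a /=; first exact: alts_from_cons.
by rewrite -addnA leq_add2l.
Qed.

Lemma alts_cat s t : (alts s + alts t <= alts (s ++ t))%N.
Proof. by case: s => [|a s] //=; exact: alts_from_cat. Qed.

Lemma alts0_nseq s : alts s = 0 -> s = nseq (size s) (head false s).
Proof.
case: s => //= a s; elim: s a => // b s IH a /=.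
by case: eqVneq => //= -> /IH {1}->.
Qed.

Fixpoint altseq (b : bool) (k : nat) : seq bool :=
  if k is k'.+1 then b :: altseq (~~ b) k' else [::].

Lemma size_altseq b k : size (altseq b k) = k.
Proof. by elim: k b => //= k IH b; rewrite IH. Qed.

Lemma altseq_prefix b p q : (p <= q)%N -> subseq (altseq b p) (altseq b q).
Proof.
elim: p q b => [|p IH] [|q] b //.
by rewrite ltnS /= eqxx => /IH.
Qed.

(** Greedy embedding: just after a letter [a] the alternating string continues with [~~ a], so a
    letter that differs from its predecessor costs one position and a repeated one costs two. The
    second conjunct keeps the truncated subtraction exact in the induction. *)
Lemma subseq_altseq_from a z :
  subseq z (altseq (~~ a) (2 * size z - alts_from a z)) /\
  (alts_from a z <= size z)%N.
Proof.
elim: z a => [|c z IH] a //; have [sz lz] := IH c.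
have -> : size (c :: z) = (size z).+1 by [].
have -> : alts_from a (c :: z) = ((a != c) + alts_from c z)%N by [].
split; last by case: (a != c); lia.
case: (eqVneq a c) => [->|nac].
  have -> : (2 * (size z).+1 - (~~ true + alts_from c z) =
             (2 * size z - alts_from c z).+2)%N by lia.
  by case: c sz {IH lz} => /=.
have -> : (2 * (size z).+1 - (~~ false + alts_from c z) =
           (2 * size z - alts_from c z).+1)%N by lia.
by case: a c nac sz {IH lz} => [] [].
Qed.

(** The first letter costs at most two positions, whichever bit the alternating string starts
    with. *)
Lemma subseq_altseq b z : subseq z (altseq b (2 * size z - alts z)).
Proof.
case: z => [|c z]; first by rewrite sub0seq.
have [sz lz] := subseq_altseq_from c z.
have -> : size (c :: z) = (size z).+1 by [].
have -> : alts (c :: z) = alts_from c z by [].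
have -> : (2 * (size z).+1 - alts_from c z =
             (2 * size z - alts_from c z).+2)%N by lia.
case: (eqVneq b c) => [->|nbc].
  have h : subseq (c :: z) (altseq c (2 * size z - alts_from c z).+1).
    by rewrite /= eqxx.
  by apply: subseq_trans h _; exact: altseq_prefix.
by case: b c nbc sz {lz} => [] [].
Qed.

Lemma nth_altseq b k i : (i < k)%N -> nth false (altseq b k) i = b (+) odd i.
Proof.
elim: k b i => // k IH b [|i] /=; first by rewrite addbF.
by rewrite ltnS => /IH ->; case: b; case: (odd i).
Qed.

(** * Stretching the trace *)

(* Copies the letters y_a, ..., y_(b-1), each about n / d times. *)
Definition stretch_pos (n d a : nat) : nat := ((a * n + d.-1) %/ d)%N.

Definition stretch (n d : nat) (y : seq bool) (a b : nat) : seq bool :=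
  [seq nth false y (i * d %/ n) |
     i <- iota (stretch_pos n d a) (stretch_pos n d b - stretch_pos n d a)].

Lemma stretch_pos_mono n d a b :
  (a <= b)%N -> (stretch_pos n d a <= stretch_pos n d b)%N.
Proof. by move=> ab; rewrite leq_div2r // leq_add2r leq_mul2r ab orbT. Qed.

(** [stretch_pos n d a] is the ceiling of a n / d, hence the first output position that copies
    letter [a] or a later one. *)
Lemma stretch_posP n d a i : (0 < d)%N -> (0 < n)%N ->
  (stretch_pos n d a <= i)%N = (a <= i * d %/ n)%N.
Proof.
move=> d0 n0; rewrite /stretch_pos leq_divRL //.
by rewrite -ltnS ltn_divLR //; apply/idP/idP; nia.
Qed.

Lemma stretch_cat n d y a b c : (a <= b <= c)%N ->
  stretch n d y a c = stretch n d y a b ++ stretch n d y b c.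
Proof.
move=> /andP[ab bc]; rewrite /stretch -map_cat; congr map.
have h1 := stretch_pos_mono n d ab; have h2 := stretch_pos_mono n d bc.
have -> : (stretch_pos n d c - stretch_pos n d a = (stretch_pos n d b - stretch_pos n d a) +
  (stretch_pos n d c - stretch_pos n d b))%N by lia.
by rewrite iotaD subnKC.
Qed.

Lemma map_const (T : eqType) (c : bool) (f : T -> bool) (s : seq T) :
  {in s, forall i, f i = c} -> map f s = nseq (size s) c.
Proof.
by move=> /eq_in_map ->; elim: s => //= i s ->.
Qed.

Lemma stretch_const n d y a b (c : bool) : (0 < d)%N -> (0 < n)%N ->
  (forall i, (a <= i < b)%N -> nth false y i = c) ->
  stretch n d y a b = nseq (stretch_pos n d b - stretch_pos n d a) c.
Proof.
move=> d0 n0 yc; rewrite /stretch (@map_const _ c) ?size_iota // => i.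
rewrite mem_iota => /andP[ai ib]; apply: yc; rewrite -stretch_posP // ai /=.
have ib' : (i < stretch_pos n d b)%N by move: ai ib; lia.
by rewrite ltnNge -stretch_posP // -ltnNge.
Qed.

Definition stretch_len_lb (n d N : nat) : nat := (N * n %/ d - 1)%N.

Lemma stretch_len n d a b : (0 < d)%N -> (a <= b)%N ->
  (stretch_len_lb n d (b - a) <= stretch_pos n d b - stretch_pos n d a)%N.
Proof.
move=> d0 ab; rewrite /stretch_len_lb /stretch_pos mulnBl.
have := leq_mul ab (leqnn n).
move: (b * n)%N (a * n)%N => p q qp.
have h1 := divn_eq (p - q) d; have h2 := divn_eq (p + d.-1) d; have h3 := divn_eq (q + d.-1) d.
have l1 := ltn_pmod (p - q) d0; have l2 := ltn_pmod (p + d.-1) d0.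
have l3 := ltn_pmod (q + d.-1) d0.
nia.
Qed.

(** * Blocks of the source and their traces *)

Definition constant_seq (s : seq bool) := s == nseq (size s) (head false s).

Lemma alts_constant s : alts s = 0 -> constant_seq s.
Proof. by move=> /alts0_nseq /eqP. Qed.

(** The blocks are cut in the source and in the mask, not in the trace: there they have a fixed
    length and independent masks. *)
Fixpoint count_blocks (P : seq bool -> seq bool -> bool) (B J : nat)
    (m x : seq bool) : nat :=
  if J is J'.+1 then
    (P (take B m) (take B x) + count_blocks P B J' (drop B m) (drop B x))%N
  else 0.

Definition nonconstant_block (m z : seq bool) : bool := ~~ constant_seq (mask m z).

(** The two bounds by [q] concern the copies of the letter in the source block and in the stretched
    trace; a run of [q] equal letters is then common to both. *)
Definition stretchable_block (n d q : nat) (m z : seq bool) : bool :=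
  [&& constant_seq (mask m z), (q <= count_mem (head false (mask m z)) z)%N
    & (q <= stretch_len_lb n d (size (mask m z)))%N].

Lemma mask_take_drop (m x : seq bool) (k : nat) : size m = size x ->
  mask m x = mask (take k m) (take k x) ++ mask (drop k m) (drop k x).
Proof.
move=> sz; rewrite -mask_cat ?cat_take_drop // !size_take sz; by [].
Qed.

Lemma take_mul_succ (T : Type) (B J : nat) (s : seq T) :
  take (J.+1 * B) s = take B s ++ take (J * B) (drop B s).
Proof.
by rewrite mulSn takeD.
Qed.

Lemma mask_take_succ (B J : nat) (m x : seq bool) : size m = size x ->
  mask (take (J.+1 * B) m) (take (J.+1 * B) x) =
  mask (take B m) (take B x) ++
  mask (take (J * B) (drop B m)) (take (J * B) (drop B x)).
Proof.
by move=> sz; rewrite !take_mul_succ mask_cat // !size_take sz.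
Qed.

(** A nonconstant trace of a block has an alternation, and alternations are superadditive under
    concatenation. *)
Lemma count_nonconstant_le_alts (B J : nat) (m x : seq bool) : size m = size x ->
  (count_blocks nonconstant_block B J m x <=
     alts (mask (take (J * B) m) (take (J * B) x)))%N.
Proof.
elim: J m x => [|J IH] m x sz //; rewrite mask_take_succ //=.
apply: leq_trans (alts_cat _ _); apply: leq_add; last first.
  by apply: IH; rewrite !size_drop sz.
rewrite /nonconstant_block; set y1 := mask (take B m) _.
by have [/alts_constant -> //|] := posnP (alts y1); case: (~~ _).
Qed.

Lemma common_subseq_stretch_block n d q (pre z m suf : seq bool) :
  (0 < d)%N -> (0 < n)%N -> stretchable_block n d q m z ->
  common_subseq
    (stretch n d (pre ++ mask m z ++ suf) (size pre) (size pre + size (mask m z)))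
    z q.
Proof.
move=> d0 n0 /and3P[]; set y := mask m z => /eqP yc qz qy.
rewrite (@stretch_const _ _ _ _ _ (head false y)) //; last first.
  move=> i /andP[ai ib]; rewrite nth_cat ltnNge ai /= nth_cat.
  have iy : (i - size pre < size y)%N by lia.
  by rewrite iy [in LHS]yc nth_nseq iy.
apply: common_subseqW (common_subseq_nseq _ _ _) => //.
rewrite leq_min qz andbT; apply: leq_trans qy _.
have := @stretch_len n d (size pre) (size pre + size y) d0 (leq_addr _ _).
by rewrite addKn.
Qed.

(** The trace [pre] of the earlier blocks is carried through the induction, because the rounding in
    [stretch] depends on absolute positions in the trace. *)
Lemma common_subseq_stretch n d q B J (pre m x : seq bool) :
  (0 < d)%N -> (0 < n)%N -> size m = size x ->
  common_subseq
    (stretch n d (pre ++ mask m x) (size pre)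
       (size pre + size (mask (take (J * B) m) (take (J * B) x))))
    (take (J * B) x) (q * count_blocks (stretchable_block n d q) B J m x).
Proof.
move=> d0 n0; elim: J pre m x => [|J IH] pre m x sz.
  by rewrite muln0; exact: common_subseq0.
have sz' : size (drop B m) = size (drop B x) by rewrite !size_drop sz.
rewrite mask_take_succ // size_cat take_mul_succ /= mulnDr.
set y1 := mask (take B m) (take B x).
rewrite (@stretch_cat n d _ (size pre) (size pre + size y1)); last first.
  by rewrite leq_addr addnA leq_addr.
rewrite (mask_take_drop B sz) -/y1; apply: common_subseq_cat.
  case: (boolP (stretchable_block _ _ _ _ _)) => [gb|_]; last first.
    by rewrite muln0; exact: common_subseq0.
  by rewrite muln1; exact: common_subseq_stretch_block.
have := IH (pre ++ y1) _ _ sz'.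
by rewrite size_cat -catA addnA.
Qed.

(** * The reconstruction *)

Definition outbit (n d : nat) (y : seq bool) (u w : nat) (b : bool) (i : nat) : bool :=
  if (i < w)%N then nth false y (i * d %/ n)
  else if (i < n - u)%N then odd i else b.

(** Parity is taken at absolute positions, so the alternating part begins with [odd w];
    [subseq_altseq] accepts either first bit. *)
Lemma mkseq_outbit n d y u w b : (w <= n - u)%N -> (u <= n)%N ->
  mkseq (outbit n d y u w b) n =
  mkseq (fun i => nth false y (i * d %/ n)) w ++
    altseq (odd w) (n - u - w) ++ nseq u b.
Proof.
move=> wn un; apply: (@eq_from_nth _ false).
  by rewrite !size_cat !size_mkseq size_altseq size_nseq; lia.
rewrite size_mkseq => i lin; rewrite nth_mkseq // /outbit nth_cat size_mkseq.
case: ltnP => [iw|wi]; first by rewrite nth_mkseq.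
rewrite nth_cat size_altseq; case: ltnP => h.
  rewrite ifT; last by lia.
  by rewrite nth_altseq; [rewrite oddB // addbC -addbA addbb addbF | lia].
rewrite ifF; last by lia.
by rewrite nth_nseq; rewrite ifT //; lia.
Qed.

(** The source is cut at [w] and at [t]. The stretched trace matches blocks of the first piece, the
    alternating part contains the middle piece entirely by [subseq_altseq], and the constant part
    meets the copies of [b] among the last 2 u letters. *)
Lemma common_subseq_outbit n d q B J u w b (m x : seq bool) :
  let t := (n - 2 * u)%N in
  (0 < d)%N -> (0 < n)%N -> size m = size x -> size x = n ->
  (J * B <= w)%N -> (w <= t)%N -> (2 * u <= n)%N ->
  (stretch_pos n d (size (mask (take (J * B) m) (take (J * B) x))) <= w)%N ->
  (2 * (t - w) - alts (drop w (take t x)) <= n - u - w)%N ->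
  common_subseq (mkseq (outbit n d (mask m x) u w b) n) x
    (q * count_blocks (stretchable_block n d q) B J m x + (t - w) +
       minn u (count_mem b (drop t x))).
Proof.
move=> t d0 n0 sz sx jw wt un sw sa.
rewrite mkseq_outbit; [|lia|lia].
have xE : take w x ++ drop w (take t x) ++ drop t x = x.
  by rewrite catA -(take_takel x wt) !cat_take_drop.
rewrite -[X in common_subseq _ X]xE -addnA; apply: common_subseq_cat; last first.
  apply: common_subseq_cat; last exact: common_subseq_nseq.
  have st : size (drop w (take t x)) = (t - w)%N.
    by rewrite size_drop size_takel // sx leq_subr.
  rewrite -[X in common_subseq _ _ X]st; apply: common_subseq_sub.
  apply: subseq_trans (subseq_altseq (odd w) _) _.
  by apply: altseq_prefix; rewrite st.
have := @common_subseq_stretch n d q B J [::] m x d0 n0 sz.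
apply: common_subseqW => //=; last first.
  rewrite -(take_takel x jw) -[X in subseq _ X](cat_take_drop (J * B)).
  by rewrite take_takel // prefix_subseq.
rewrite /stretch add0n.
have -> : stretch_pos n d 0 = 0 by rewrite /stretch_pos mul0n add0n divn_small // prednK.
rewrite subn0; apply: map_subseq.
by rewrite -[X in iota 0 X](subnKC sw) iotaD prefix_subseq.
Qed.

(** * Expectations over a random mask, and exponential moments *)

Section Expectation.
Variables (R : realType) (rho : R).
Hypothesis rho01 : 0 <= rho <= 1.
Implicit Types (n : nat) (f g : seq bool -> R) (m x : seq bool).

(** Expectation over [n] independent bits, each true with probability [rho]; the recursion reveals
    one bit at a time. *)
Fixpoint mask_expect n f : R :=
  if n is n'.+1 then
    rho * mask_expect n' (fun m => f (true :: m)) +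
    (1 - rho) * mask_expect n' (fun m => f (false :: m))
  else f [::].

Let rho0 : 0 <= rho. Proof. by case/andP: rho01. Qed.
Let rho1 : 0 <= 1 - rho. Proof. by rewrite subr_ge0; case/andP: rho01. Qed.

Lemma mask_expect_le n f g : (forall m, size m = n -> f m <= g m) ->
  mask_expect n f <= mask_expect n g.
Proof.
elim: n f g => [|n IH] f g fg /=; first exact: fg.
by apply: lerD; apply: ler_wpM2l => //; apply: IH => m sm; apply: fg; rewrite /= sm.
Qed.

Lemma mask_expect_cst n (a : R) : mask_expect n (fun=> a) = a.
Proof. by elim: n => //= n ->; rewrite -mulrDl subrKC mul1r. Qed.

Lemma mask_expect_ge0 n f : (forall m, 0 <= f m) -> 0 <= mask_expect n f.
Proof. by move=> f0; rewrite -(mask_expect_cst n 0); apply: mask_expect_le. Qed.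

Lemma mask_expectZ n (a : R) f : mask_expect n (fun m => a * f m) = a * mask_expect n f.
Proof. by elim: n f => //= n IH f; rewrite !IH; ring. Qed.

Lemma mask_expectD n f g : mask_expect n (fun m => f m + g m) = mask_expect n f + mask_expect n g.
Proof. by elim: n f g => //= n IH f g; rewrite !IH; ring. Qed.

Lemma mask_expect_cat a b f :
  mask_expect (a + b) f = mask_expect a (fun m1 => mask_expect b (fun m2 => f (m1 ++ m2))).
Proof. by elim: a f => //= a IH f; rewrite !IH. Qed.

Lemma mask_expect_take_drop a b f g :
  mask_expect (a + b) (fun m => f (take a m) * g (drop a m)) = mask_expect a f * mask_expect b g.
Proof.
(* Two inequalities, since [mask_expect_le] supplies the length of [m1] that is needed to split the
   concatenation. *)
rewrite mask_expect_cat mulrC -mask_expectZ; apply/eqP; rewrite eq_le; apply/andP; split;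
  apply: mask_expect_le => m1 sm; rewrite [_ * f m1]mulrC -mask_expectZ;
  by apply: mask_expect_le => m2 _; rewrite take_size_cat ?drop_size_cat.
Qed.

(** From exp(-x) >= 1 - x one gets exp(x) <= 1 / (1 - x), and (1 + x + 2 x^2)(1 - x) = 1 + x^2 (1 -
    2 x) is at least 1. *)
Lemma expR_le_quadratic (x : R) : x <= 2^-1 -> expR x <= 1 + x + 2 * x ^+ 2.
Proof.
move=> x2; have h := expR_ge1Dx (- x); rewrite expRN in h.
have h' : (1 - x) * expR x <= 1.
  have := ler_wpM2r (expR_ge0 x) h; rewrite mulVf ?gt_eqF ?expR_gt0 //.
have hx : 0 < 1 - x by lra.
have : expR x <= (1 - x)^-1 by rewrite -[_^-1]mulr1 ler_pdivlMl // mulrC.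
move=> /le_trans; apply; rewrite -[_^-1]mul1r ler_pdivrMr //; nra.
Qed.

(** A linear form in the centred mask bits. Lengths, letter counts and biases of traces are all
    reduced to such forms. *)
Fixpoint lin (c : seq R) m : R :=
  match c, m with
  | a :: c', b :: m' => a * (b%:R - rho) + lin c' m'
  | _, _ => 0
  end.

Lemma lin_cat c1 c2 m : (size c1 <= size m)%N ->
  lin (c1 ++ c2) m = lin c1 (take (size c1) m) + lin c2 (drop (size c1) m).
Proof.
elim: c1 m => [|a c1 IH] m; first by rewrite drop0 /= add0r.
by case: m => //= b m; rewrite ltnS => /IH ->; rewrite addrA.
Qed.

Lemma lin_nseq0 k m : lin (nseq k 0) m = 0.
Proof. by elim: k m => [|k IH] [|b m] //=; rewrite mul0r IH addr0. Qed.

Lemma lin_map (h : bool -> R) x m : size m = size x ->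
  lin (map h x) m = \sum_(b <- mask m x) h b - rho * \sum_(b <- x) h b.
Proof.
elim: x m => [|a x IH] [|[] m] //=; first by rewrite !big_nil mulr0 subr0.
  by move=> [sm]; rewrite !big_cons IH //; ring.
by move=> [sm]; rewrite big_cons IH //; ring.
Qed.

(** Independence splits off one factor per bit. In each factor the linear term has mean zero, and
    [expR_le_quadratic] leaves an excess of at most 2 lam^2 rho. *)
Lemma lin_mgf (lam : R) (c : seq R) : 0 <= lam <= 2^-1 ->
  all (fun a => `|a| <= 1) c ->
  mask_expect (size c) (fun m => expR (lam * lin c m)) <=
    expR (2 * lam ^+ 2 * rho * (size c)%:R).
Proof.
move=> lam01; elim: c => [|a c IH]; first by rewrite /= !mulr0.
move=> /=/andP[a1 /IH {}IH].
have step (b : bool) : mask_expect (size c) (fun m => expR (lam * (a * (b%:R - rho) + lin c m))) =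
    expR (lam * a * (b%:R - rho)) * mask_expect (size c) (fun m => expR (lam * lin c m)).
  rewrite -mask_expectZ; congr (mask_expect _ _); apply/funext => m.
  by rewrite -expRD; congr expR; ring.
change (rho * mask_expect (size c) (fun m => expR (lam * (a * (true%:R - rho) + lin c m))) +
  (1 - rho) * mask_expect (size c) (fun m => expR (lam * (a * (false%:R - rho) + lin c m)))
  <= expR (2 * lam ^+ 2 * rho * (size c).+1%:R)).
rewrite (step true) (step false) mulrA [X in _ + X]mulrA -mulrDl.
have -> : 2 * lam ^+ 2 * rho * (size c).+1%:R =
  2 * lam ^+ 2 * rho + 2 * lam ^+ 2 * rho * (size c)%:R by rewrite -natr1; ring.
rewrite expRD; apply: ler_pM => //.
- by rewrite addr_ge0 // mulr_ge0 // expR_ge0.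
- by apply: mask_expect_ge0 => m; exact: expR_ge0.
- apply: le_trans (expR_ge1Dx _).
  case/andP: lam01 => l0 l1; case/andP: rho01 => r0 r1.
  move: a1; rewrite ler_norml => /andP[a0 a1].
  set z := lam * a.
  have zl : - lam <= z <= lam by rewrite /z; apply/andP; split; nra.
  have z2 : z ^+ 2 <= lam ^+ 2 by case/andP: zl => ? ?; nra.
  have e1 : expR (z * (1 - rho)) <= 1 + z * (1 - rho) + 2 * (z * (1 - rho)) ^+ 2.
    by apply: expR_le_quadratic; case/andP: zl => ? ?; nra.
  have e0 : expR (z * (0 - rho)) <= 1 + z * (0 - rho) + 2 * (z * (0 - rho)) ^+ 2.
    by apply: expR_le_quadratic; case/andP: zl => ? ?; nra.
  have := lerD (ler_wpM2l rho0 e1) (ler_wpM2l rho1 e0).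
  move=> /le_trans; apply.
  have -> : rho * (1 + z * (1 - rho) + 2 * (z * (1 - rho)) ^+ 2) +
    (1 - rho) * (1 + z * (0 - rho) + 2 * (z * (0 - rho)) ^+ 2) =
    1 + 2 * z ^+ 2 * rho * (1 - rho) by ring.
  rewrite lerD2l.
  have h : 0 <= z ^+ 2 by exact: sqr_ge0.
  have h2 : z ^+ 2 * (rho * (1 - rho)) <= lam ^+ 2 * rho.
    apply: ler_pM => //; first by rewrite mulr_ge0.
    nra.
  lra.
Qed.

(** Chernoff bound with lam = a / (4 rho s), where s is the size of [c]: this minimises 2 lam^2 rho
    s - lam a, and the upper bound on [a] says that lam <= 1/2. *)
Lemma lin_tail (c : seq R) (a : R) : all (fun a => `|a| <= 1) c -> 0 < rho ->
  (0 < size c)%N -> 0 <= a <= 2 * rho * (size c)%:R ->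
  mask_expect (size c) (fun m => (a <= lin c m)%R%:R) <=
    expR (- (a ^+ 2 / (8 * rho * (size c)%:R))).
Proof.
move=> c1 r0 sc /andP[a0 a1]; set s := (size c)%:R in a1 *.
have s0 : 0 < s by rewrite ltr0n.
have rs0 : 0 < rho * s by exact: mulr_gt0.
pose lam := a / (4 * rho * s).
have lam01 : 0 <= lam <= 2^-1.
  rewrite /lam divr_ge0 //=; last by nra.
  rewrite ler_pdivrMr; last by nra.
  nra.
have := lin_mgf lam01 c1; rewrite -/s.
have -> : 2 * lam ^+ 2 * rho * s = lam * a - a ^+ 2 / (8 * rho * s).
  by rewrite /lam; field; rewrite ?gt_eqF.
rewrite expRD; move=> h.
have := ler_wpM2l (expR_ge0 (- (lam * a))) h.
rewrite mulrA -expRD addNr expR0 mul1r -mask_expectZ; move=> /(le_trans _); apply.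
apply: mask_expect_le => m _; rewrite -expRD.
have [al|_] := leP a (lin c m); last by rewrite mulr0n expR_ge0.
rewrite -[X in X <= _]expR0 ler_expR; case/andP: lam01 => l0 _; nra.
Qed.

(** Distinct blocks have independent masks, so the exponential moment factors. *)
Lemma count_blocks_mgf (P : seq bool -> seq bool -> bool) (p : R) B J n x :
  (forall z, size z = B -> mask_expect B (fun m => (P m z)%:R) <= p) ->
  size x = n -> (J * B <= n)%N ->
  mask_expect n (fun m => expR (count_blocks P B J m x)%:R) <= expR (3 * p * J%:R).
Proof.
move=> Pp; elim: J n x => [|J IH] n x sx jn.
  by rewrite /= mask_expect_cst !mulr0.
have Bn : (B <= n)%N by rewrite (leq_trans _ jn) // mulSn leq_addr.
have nE : n = (B + (n - B))%N by rewrite subnKC.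
rewrite nE.
pose f m := expR ((P m (take B x))%:R : R).
pose g m := expR ((count_blocks P B J m (drop B x))%:R : R).
have -> : (fun m => expR (count_blocks P B J.+1 m x)%:R) =
          (fun m => f (take B m) * g (drop B m)).
  by apply/funext => m; rewrite /f /g -expRD -natrD.
rewrite mask_expect_take_drop.
have -> : 3 * p * J.+1%:R = 3 * p + 3 * p * J%:R by rewrite -natr1; ring.
rewrite expRD; apply: ler_pM.
- by apply: mask_expect_ge0 => m; exact: expR_ge0.
- by apply: mask_expect_ge0 => m; exact: expR_ge0.
- apply: le_trans (expR_ge1Dx _).
  (* For an indicator v, exp(v) <= 1 + 3 v, because exp(1/2) <= 2 gives exp(1) <= 4. *)
  have h : mask_expect B f <= mask_expect B (fun m => 1 + 3 * (P m (take B x))%:R).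
    apply: mask_expect_le => m _; rewrite /f; case: (P _ _).
      have := @expR_le_quadratic (2^-1) (lexx _).
      have e : expR (1 : R) = expR 2^-1 * expR 2^-1.
        by rewrite -expRD; congr expR; lra.
      move=> h; rewrite mulr1n mulr1 e; have h0 := expR_ge0 (2^-1 : R).
      have h2 : expR 2^-1 <= 2 :> R by lra.
      have := ler_pM h0 h0 h2 h2; lra.
    by rewrite mulr0n expR0; lra.
  apply: le_trans h _; rewrite mask_expectD mask_expect_cst mask_expectZ lerD2l.
  by rewrite ler_pM2l // Pp // size_takel // sx.
- by apply: IH; [rewrite size_drop sx | move: jn; rewrite mulSn; lia].
Qed.
End Expectation.

Lemma mask_expect_tuple (R : realType) (delta : R) (n : nat) (f : seq bool -> R) :
  mask_expect (1 - delta) n f =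
  \sum_(m : n.-tuple bool)
     (\prod_(i < n) (if tnth m i then 1 - delta else delta)) * f m.
Proof.
elim: n f => [|n IH] f /=.
  rewrite (bigD1 [tuple]) //= [X in _ + X]big1 ?addr0; last first.
    by move=> m /eqP[]; exact: tuple0.
  by rewrite big_ord0 mul1r.
rewrite !IH !big_distrr /=.
rewrite (reindex (fun p : bool * n.-tuple bool => [tuple of p.1 :: p.2])) /=; last first.
  exists (fun t : n.+1.-tuple bool => (thead t, [tuple of behead t])).
    by move=> [b t] _; congr pair; apply: val_inj.
  by move=> t _; rewrite [RHS]tuple_eta.
rewrite -(pair_bigA _ (fun (b : bool) (t : n.-tuple bool) =>
   (\prod_(i < n.+1) (if tnth [tuple of b :: t] i then 1 - delta else delta)) *
     f (b :: t))) /= big_bool.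
congr (_ + _); apply: eq_bigr => t _; rewrite big_ord_recl mulrA;
  congr (_ * _ * _); rewrite ?(tnth_nth false) ?opprB ?subrKC //=;
  by apply: eq_bigr => i _; rewrite !(tnth_nth false).
Qed.

(** Every mask determines one trace, so the comparison is made mask by mask. The function [g] may be
    negative, which suits one minus a sum of bad events. *)
Lemma mask_expect_le_del_prob (R : realType) (delta : R) (n : nat) (x : n.-tuple bool)
    (E : pred (n.-bseq bool)) (g : seq bool -> R) : 0 <= delta <= 1 ->
  (forall (m : seq bool) (y : n.-bseq bool), size m = n ->
     y = mask m x :> seq bool -> g m <= (E y)%:R) ->
  mask_expect (1 - delta) n g <= del_prob delta x E.
Proof.
move=> d01 gE; rewrite mask_expect_tuple /del_prob /del_pmf.
under [leRHS]eq_bigr do rewrite big_mkcond.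
rewrite /= exchange_big /=; apply: ler_sum => m _.
have sy : (size (mask m x) <= n)%N.
  by rewrite size_mask ?size_tuple // -[X in (_ <= X)%N](size_tuple m) count_size.
have w0 : 0 <= \prod_(i < n) (if tnth m i then 1 - delta else delta).
  by apply: prodr_ge0 => i _; case: ifP; lra.
set W := \prod_(i < n) _ in w0 *.
have sum0 (y : n.-bseq bool) : 0 <= (if mask m x == y :> seq bool then W else 0).
  by case: ifP.
pose y0 : n.-bseq bool := Bseq sy.
have := gE m y0 (size_tuple m) erefl; case Ey0: (E y0) => gm.
  rewrite (bigD1 y0) //= eqxx -[leLHS]addr0 lerD //; last exact: sumr_ge0.
  by rewrite -[leRHS]mulr1 ler_wpM2l.
apply: (@le_trans _ _ 0); last exact: sumr_ge0.
by rewrite -[leRHS](mulr0 W) ler_wpM2l.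
Qed.

(** * Typical blocks *)

Section Blocks.
Variables (R : realType) (rho : R).
Hypothesis rho01 : 0 < rho <= 1.

Let ind (b : bool) (e : bool) : R := (e == b)%:R.

Lemma sum_ind b (s : seq bool) : \sum_(e <- s) ind b e = (count_mem b s)%:R.
Proof. by elim: s => [|a s IH]; rewrite ?big_nil //= big_cons IH natrD. Qed.

(** In the trace the letter [b] falls short of its expected count by at least 4 percent of rho |z|.
    Negated coefficients turn this lower deviation into an upper tail of [lin]. *)
Definition few_hits (b : bool) (m z : seq bool) : bool :=
  (4/100 * rho * (size z)%:R <= lin rho [seq - ind b e | e <- z] m).

Lemma few_hitsN b m z : size m = size z -> ~~ few_hits b m z ->
  rho * (count_mem b z)%:R - 4/100 * rho * (size z)%:R < (count_mem b (mask m z))%:R.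
Proof.
move=> sm; rewrite /few_hits -ltNge lin_map // !sumrN !sum_ind; lra.
Qed.

Lemma few_hits_prob b z : (0 < size z)%N ->
  mask_expect rho (size z) (fun m => (few_hits b m z)%:R) <=
    expR (- (rho * (size z)%:R / 50 / 100)).
Proof.
move=> sz; have r0 : 0 < rho by case/andP: rho01.
have r01 : 0 <= rho <= 1 by case/andP: rho01 => ? ?; lra.
have s0 : 0 < (size z)%:R :> R by rewrite ltr0n.
have rs : 0 < rho * (size z)%:R by exact: mulr_gt0.
have h1 : all (fun a : R => `|a| <= 1) [seq - ind b e | e <- z].
  apply/allP => a /mapP[e _ ->]; rewrite normrN ger0_norm ?ler0n //.
  by rewrite /ind; case: (e == b).
have := @lin_tail R rho r01 [seq - ind b e | e <- z] (4/100 * rho * (size z)%:R) h1 r0.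
rewrite size_map => /(_ sz) h; apply: le_trans (h _) _.
  by apply/andP; split; nra.
rewrite ler_expR lerN2 le_eqVlt; apply/orP; left; apply/eqP.
by field; rewrite !gt_eqF.
Qed.

(** If the trace of [z] is constant, the other letter does not survive at all, so it makes up less
    than 4 percent of [z]. The surviving letter fills at least 96 percent of [z], and its trace is
    longer than 92 percent of rho |z|; stretching by n / d >= 1 / rho gives 92 percent of |z|, and
    |z| >= 100 pays for the rounding. *)
Lemma block_typical (n d q : nat) m z : size m = size z -> (0 < size z)%N ->
  (0 < d)%N -> d%:R <= rho * n%:R ->
  q%:R <= 90/100 * (size z)%:R :> R -> 100 <= (size z)%:R :> R ->
  ~~ few_hits true m z -> ~~ few_hits false m z ->
  nonconstant_block m z || stretchable_block n d q m z.
Proof.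
move=> sm sz d0 dn qz z100 /(few_hitsN sm) ht /(few_hitsN sm) hf.
rewrite /nonconstant_block /stretchable_block.
have [|] //= := boolP (constant_seq _); rewrite /constant_seq; set y := mask m z.
move=> /eqP yc; set b := head false y in yc *.
have r0 : 0 < rho by case/andP: rho01.
have d0R : 0 < d%:R :> R by rewrite ltr0n.
have hs : rho * (count_mem b z)%:R - 4/100 * rho * (size z)%:R < (count_mem b y)%:R.
  by case: (b).
have hs' : rho * (count_mem (~~ b) z)%:R - 4/100 * rho * (size z)%:R < (count_mem (~~ b) y)%:R.
  by case: (b).
have cb : count_mem b y = size y by rewrite [in LHS]yc count_nseq /= eqxx mul1n.
have cnb : count_mem (~~ b) y = 0.
  by rewrite [in LHS]yc count_nseq /=; case: (b).
have cz : (count_mem b z + count_mem (~~ b) z = size z)%N.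
  rewrite -(count_predC (pred1 b) z); congr (_ + _)%N; apply: eq_count => e /=.
  by case: (e) (b) => [] [].
rewrite cb in hs; rewrite cnb in hs'.
have czR : (count_mem b z)%:R + (count_mem (~~ b) z)%:R = (size z)%:R :> R by rewrite -natrD cz.
have small : (count_mem (~~ b) z)%:R < 4/100 * (size z)%:R :> R.
  by rewrite -(ltr_pM2l r0); lra.
have big : 96/100 * (size z)%:R <= (count_mem b z)%:R :> R by lra.
have sy : 92/100 * rho * (size z)%:R < (size y)%:R by nra.
apply/andP; split; first by rewrite -(ler_nat R); lra.
rewrite /stretch_len_lb -(ler_nat R).
have lb : (size y * n)%:R < ((size y * n %/ d).+1 * d)%:R :> R.
  by rewrite ltr_nat {1}(divn_eq (size y * n) d) mulSn addnC ltn_add2r ltn_pmod.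
have ub : 92/100 * (size z)%:R < ((size y * n %/ d).+1)%:R :> R.
  rewrite -(ltr_pM2r d0R); rewrite !natrM in lb *; apply: le_lt_trans lb.
  apply: (@le_trans _ _ (92/100 * (size z)%:R * (rho * n%:R))).
    by rewrite ler_pM2l //; nra.
  have : 0 <= n%:R :> R by [].
  nra.
have : ((size y * n %/ d).+1)%:R - 2 <= (size y * n %/ d - 1)%:R :> R.
  case: (_ %/ _)%N => [|k]; first by rewrite sub0n; lra.
  by rewrite subn1 /= -[k.+2]addn2 natrD; lra.
lra.
Qed.

Definition atypical_block (m z : seq bool) : bool := few_hits true m z || few_hits false m z.

(** A union bound over the two letters; exp(-v) <= 1 / (1 + v) suffices for each. *)
Lemma atypical_block_prob z : 120 <= rho * (size z)%:R / 50 / 100 ->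
  mask_expect rho (size z) (fun m => (atypical_block m z)%:R) <= 60^-1.
Proof.
move=> hz; have r0 : 0 < rho by case/andP: rho01.
have r01 : 0 <= rho <= 1 by case/andP: rho01 => ? ?; lra.
have sz : (0 < size z)%N.
  by case: (size z) hz => //; rewrite mulr0; lra.
apply: (@le_trans _ _ (mask_expect rho (size z)
  (fun m => (few_hits true m z)%:R + (few_hits false m z)%:R))).
  apply: mask_expect_le => // m _; rewrite /atypical_block -natrD ler_nat.
  by case: (few_hits true m z) (few_hits false m z) => [] [].
rewrite mask_expectD.
have h1 := few_hits_prob true sz; have h2 := few_hits_prob false sz.
have e : expR (- (rho * (size z)%:R / 50 / 100)) <= 120^-1.
  rewrite expRN lef_pV2 ?posrE ?expR_gt0 //.
  by apply: le_trans (expR_ge1Dx (rho * (size z)%:R / 50 / 100)); lra.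
lra.
Qed.

Lemma count_blocks_cover (n d q B J : nat) (m x : seq bool) : size m = size x ->
  (J * B <= size x)%N -> (0 < d)%N -> d%:R <= rho * n%:R ->
  q%:R <= 90/100 * B%:R :> R -> 100 <= B%:R :> R ->
  (J <= count_blocks nonconstant_block B J m x +
        count_blocks (stretchable_block n d q) B J m x +
        count_blocks atypical_block B J m x)%N.
Proof.
move=> sm jx d0 dn qB B100; elim: J m x sm jx => // J IH m x sm jx /=.
have Bx : (B <= size x)%N by rewrite (leq_trans _ jx) // mulSn leq_addr.
have := IH (drop B m) (drop B x).
rewrite !size_drop sm => /(_ erefl) h.
have {}h := h ltac:(by move: jx; rewrite mulSn; lia).
have szB : size (take B x) = B by rewrite size_takel.
have smB : size (take B m) = size (take B x) by rewrite !size_takel // sm.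
have key : (0 < nonconstant_block (take B m) (take B x) +
  stretchable_block n d q (take B m) (take B x) + atypical_block (take B m) (take B x))%N.
  case: (boolP (atypical_block _ _)) => [_|]; first by rewrite addn1.
  rewrite negb_or => /andP[ht hf].
  have B0 : (0 < B)%N by rewrite -(ltr_nat R); lra.
  have := @block_typical n d q _ _ smB; rewrite szB => /(_ B0 d0 dn qB B100 ht hf).
  by case: (nonconstant_block _ _) => //=; case: (stretchable_block _ _ _ _ _).
lia.
Qed.

(** Markov's inequality for the exponential moment: a block is atypical with probability at most
    1/60, and -1/10 + 3/60 = -1/20. *)
Lemma atypical_blocks_prob (B J n : nat) (x : seq bool) : size x = n ->
  (J * B <= n)%N -> 120 <= rho * B%:R / 50 / 100 ->
  mask_expect rho n (fun m => (J <= 10 * count_blocks atypical_block B J m x)%:R) <=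
    expR (- (J%:R / 20)).
Proof.
move=> sx jn hB.
have r01 : 0 <= rho <= 1 by case/andP: rho01 => ? ?; lra.
have := @count_blocks_mgf R rho r01 atypical_block 60^-1 B J n x _ sx jn.
have hp (z : seq bool) : size z = B ->
    mask_expect rho B (fun m => (atypical_block m z)%:R) <= 60^-1.
  by move=> zB; have := @atypical_block_prob z; rewrite zB; apply.
move=> /(_ hp) h.
have -> : - (J%:R / 20) = - (J%:R / 10) + 3 * 60^-1 * J%:R :> R by field.
rewrite expRD; apply: le_trans (ler_wpM2l (expR_ge0 _) h).
rewrite -mask_expectZ; apply: mask_expect_le => // m _; rewrite -expRD.
case: (boolP (J <= _)%N) => [hJ|_]; last by rewrite mulr0n expR_ge0.
rewrite mulr1n -[leLHS]expR0 ler_expR.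
move: hJ; rewrite -(ler_nat R) natrM; lra.
Qed.

End Blocks.

(** * Position and bias of the trace *)

Section Bias.
Variables (R : realType).
Implicit Types (x y m s : seq bool).

Definition sgnb (e : bool) : R := if e then 1 else -1.

Definition bias s : R := \sum_(e <- s) sgnb e.

Lemma bias_cat s1 s2 : bias (s1 ++ s2) = bias s1 + bias s2.
Proof. exact: big_cat. Qed.

Lemma norm_bias s : `|bias s| <= (size s)%:R.
Proof.
rewrite /bias; elim: s => [|e s IH]; first by rewrite big_nil normr0.
rewrite big_cons -natr1 [leRHS]addrC; apply: le_trans (ler_normD _ _) _; apply: lerD => //.
by rewrite /sgnb; case: e; rewrite ?normrN normr1.
Qed.

Lemma biasE (b : bool) s : sgnb b * bias s = 2 * (count_mem b s)%:R - (size s)%:R.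
Proof.
rewrite /bias; elim: s => [|e s IH]; first by rewrite big_nil /=; lra.
by rewrite big_cons mulrDr IH /= natrD -natr1 /sgnb; case: b {IH}; case: e => /=; lra.
Qed.

(** Cutting at [k] instead of at the true boundary adds or removes at most |k - |y1|| letters, each
    contributing 1 or -1. *)
Lemma bias_drop y1 y2 k :
  `|bias (drop k (y1 ++ y2)) - bias y2| <= `|k%:R - (size y1)%:R|.
Proof.
rewrite drop_cat; case: ltnP => hk.
  rewrite bias_cat addrK (le_trans (norm_bias _)) // size_drop natrB 1?ltnW //.
  by rewrite distrC ler_norm.
rewrite -[X in _ - bias X](cat_take_drop (k - size y1)) bias_cat.
rewrite opprD addrCA subrr addr0 normrN (le_trans (norm_bias _)) //.
rewrite -natrB // normr_nat ler_nat size_take; case: ltnP => //; lia.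
Qed.

Variable (rho : R).
Hypothesis rho01 : 0 < rho <= 1.

(** Padding with zeros makes the form live on the whole mask, so that one tail bound in terms of |x|
    serves every [t]. *)
Definition prefix_coef (a : R) (t : nat) x : seq R :=
  [seq a | _ <- take t x] ++ nseq (size x - t) 0.

Definition suffix_coef (a : R) (t : nat) x : seq R :=
  nseq t 0 ++ [seq a * sgnb e | e <- drop t x].

Lemma sum_cst_seq (T : Type) (s : seq T) (a : R) : \sum_(i <- s) a = (size s)%:R * a.
Proof.
elim: s => [|e s IH]; first by rewrite big_nil mul0r.
by rewrite big_cons IH /= -natr1 mulrDl mul1r addrC.
Qed.

Lemma lin_prefix_coef a t m x : size m = size x -> (t <= size x)%N ->
  lin rho (prefix_coef a t x) m =
    a * ((size (mask (take t m) (take t x)))%:R - rho * t%:R).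
Proof.
move=> sm tx; rewrite lin_cat; last by rewrite size_map size_takel // sm.
rewrite lin_nseq0 addr0 size_map size_takel // lin_map; last by rewrite !size_takel // sm.
by rewrite !sum_cst_seq size_takel //; ring.
Qed.

Lemma lin_suffix_coef a t m x : size m = size x -> (t <= size x)%N ->
  lin rho (suffix_coef a t x) m =
    a * (bias (mask (drop t m) (drop t x)) - rho * bias (drop t x)).
Proof.
move=> sm tx; rewrite lin_cat; last by rewrite size_nseq sm.
rewrite lin_nseq0 add0r size_nseq lin_map; last by rewrite !size_drop // sm.
by rewrite -!big_distrr /=; rewrite -/(bias _) -/(bias _); ring.
Qed.

(** The two signs turn the two-sided deviations, of the length of the prefix trace and of the bias
    of the suffix trace, into upper tails. *)
Definition deviates (a : R) (t : nat) x m : bool :=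
  [|| a <= lin rho (prefix_coef 1 t x) m, a <= lin rho (prefix_coef (-1) t x) m,
      a <= lin rho (suffix_coef 1 t x) m | a <= lin rho (suffix_coef (-1) t x) m].

Lemma deviatesN a t x m : size m = size x -> (t <= size x)%N -> ~~ deviates a t x m ->
  `|(size (mask (take t m) (take t x)))%:R - rho * t%:R| <= a /\
  `|bias (mask (drop t m) (drop t x)) - rho * bias (drop t x)| <= a.
Proof.
move=> sm tx; rewrite /deviates !lin_prefix_coef // !lin_suffix_coef //.
rewrite !negb_or -!ltNge => /and4P[h1 h2 h3 h4].
by split; rewrite ler_norml; apply/andP; split; lra.
Qed.

Lemma deviates_prob a t x : (0 < size x)%N -> (t <= size x)%N ->
  0 <= a <= 2 * rho * (size x)%:R ->
  mask_expect rho (size x) (fun m => (deviates a t x m)%:R) <=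
    4 * expR (- (a ^+ 2 / (8 * rho * (size x)%:R))).
Proof.
move=> x0 tx an; have r0 : 0 < rho by case/andP: rho01.
have r01 : 0 <= rho <= 1 by case/andP: rho01 => ? ?; lra.
have tail c : size c = size x -> all (fun a : R => `|a| <= 1) c ->
    mask_expect rho (size x) (fun m => (a <= lin rho c m)%R%:R) <=
      expR (- (a ^+ 2 / (8 * rho * (size x)%:R))).
  by move=> cx c1; have := @lin_tail R rho r01 c a c1 r0; rewrite cx; apply.
have sp e : size (prefix_coef e t x) = size x.
  by rewrite size_cat size_map size_takel // size_nseq subnKC.
have ss e : size (suffix_coef e t x) = size x.
  by rewrite size_cat size_map size_drop size_nseq subnKC.
have n1 : `|-1 : R| <= 1 by rewrite normrN normr1.
have n2 : `|1 : R| <= 1 by rewrite normr1.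
have n0 k : all (fun a : R => `|a| <= 1) (nseq k 0).
  by apply/allP => e /nseqP[-> _]; rewrite normr0.
have ap e : `|e| <= 1 -> all (fun a : R => `|a| <= 1) (prefix_coef e t x).
  by move=> e1; rewrite all_cat n0 andbT; apply/allP => f /mapP[? _ ->].
have aS e : `|e| <= 1 -> all (fun a : R => `|a| <= 1) (suffix_coef e t x).
  move=> e1; rewrite all_cat n0 /=; apply/allP => f /mapP[g _ ->].
  by rewrite normrM /sgnb; case: g; rewrite ?n1 ?normrN normr1 mulr1.
have t1 := tail _ (sp 1) (ap _ n2); have t2 := tail _ (sp (-1)) (ap _ n1).
have t3 := tail _ (ss 1) (aS _ n2); have t4 := tail _ (ss (-1)) (aS _ n1).
apply: (@le_trans _ _ (mask_expect rho (size x) (fun m =>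
  ((a <= lin rho (prefix_coef 1 t x) m)%R%:R + (a <= lin rho (prefix_coef (-1) t x) m)%R%:R) +
  ((a <= lin rho (suffix_coef 1 t x) m)%R%:R + (a <= lin rho (suffix_coef (-1) t x) m)%R%:R)))).
  apply: mask_expect_le => // m _; rewrite /deviates -!natrD ler_nat.
  by do 4!case: (a <= _).
rewrite !mask_expectD; lra.
Qed.

(** The errors add up to 3 a: one [a] for the bias of the true suffix trace, and two for the cut,
    since [k] and the true boundary are both within [a] of rho t. The choice of [b] makes the
    observed bias towards [b] nonnegative. *)
Lemma majority_count a t k m x (b : bool) : size m = size x -> (t <= size x)%N ->
  ~~ deviates a t x m -> `|k%:R - rho * t%:R| <= a ->
  b = (size (mask m x) - k < 2 * count id (drop k (mask m x)))%N ->
  rho * ((size x)%:R - t%:R) - 3 * a <= 2 * rho * (count_mem b (drop t x))%:R.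
Proof.
move=> sm tx dv kt bE; have [h1 h2] := deviatesN sm tx dv.
have := @bias_drop (mask (take t m) (take t x)) (mask (drop t m) (drop t x)) k.
rewrite -mask_take_drop // => h3.
have sg : 0 <= sgnb b * bias (drop k (mask m x)).
  rewrite biasE size_drop; have -> : count_mem b (drop k (mask m x)) =
    (if b then count id (drop k (mask m x)) else
      (size (mask m x) - k) - count id (drop k (mask m x)))%N.
    have := count_predC id (drop k (mask m x)); rewrite size_drop.
    have -> : count_mem b = count (if b then id else predC id).
      by apply/funext => s; apply: eq_count => -[]; case: (b).
    by case: (b) => //=; lia.
  rewrite bE; case: ltnP => hc.
    by rewrite subr_ge0 -natrM ler_nat ltnW.
  by rewrite subr_ge0 -natrM ler_nat; lia.
have := biasE b (drop t x); rewrite size_drop natrB // => hb.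
have : - (3 * a) <= rho * (sgnb b * bias (drop t x)).
  move: h1 h2 h3 kt sg; rewrite /sgnb; set N := (size (mask (take t m) _))%:R.
  rewrite ler_norml => /andP[a1 a2]; rewrite ler_norml => /andP[b1 b2].
  rewrite ler_norml => /andP[c1 c2]; rewrite ler_norml => /andP[e1 e2].
  have : `|k%:R - N| <= 2 * a by rewrite ler_norml; apply/andP; split; lra.
  by case: (b) => h sg; lra.
rewrite hb; lra.
Qed.

End Bias.

(** * Parameters read off the trace *)

Definition front_alts (d : nat) (y : seq bool) : nat :=
  alts (mkseq (nth false y) (d %/ 4)).

Definition many_alts (G d : nat) (y : seq bool) : bool := (d %/ G <= front_alts d y)%N.

(** With g = d / G alternations, the alternating part of length n - u has to hold the first n - 2 u
    letters, that is n <= g + 3 u; this explains the ceiling of (n - g) / 3. Otherwise a quarter is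
    stretched, half alternates and a quarter is constant. *)
Definition tail_len (G n d : nat) (y : seq bool) : nat :=
  if many_alts G d y then ((n - d %/ G + 2) %/ 3)%N else ((n + 3) %/ 4)%N.

Definition front_len (G n d : nat) (y : seq bool) : nat :=
  if many_alts G d y then 0 else ((n + 3) %/ 4)%N.

(** [k] estimates where the trace of the last 2 u source letters begins. *)
Definition tail_bit (n d : nat) (y : seq bool) (u : nat) : bool :=
  let k := ((n - 2 * u) * d %/ n)%N in
  (size y - k < 2 * count id (drop k y))%N.

Definition reconstruct (G n d : nat) (y : seq bool) : nat -> bool :=
  let u := tail_len G n d y in
  outbit n d y u (front_len G n d y) (tail_bit n d y u).

Lemma front_alts_take (d : nat) (y : seq bool) :
  (d %/ 4 <= size y)%N -> front_alts d y = alts (take (d %/ 4) y).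
Proof.
move=> dy; congr alts; apply: (@eq_from_nth _ false).
  by rewrite size_mkseq size_takel.
by rewrite size_mkseq => i id; rewrite nth_mkseq // nth_take.
Qed.

Lemma prefix_mask_take (m x : seq bool) (t h : nat) : size m = size x ->
  (h <= size (mask (take t m) (take t x)))%N ->
  take h (mask m x) = take h (mask (take t m) (take t x)).
Proof. by move=> sm hN; rewrite (mask_take_drop t sm) takel_cat. Qed.

Lemma ceil_third (k g : nat) : (g <= k)%N -> (k <= g + 3 * ((k - g + 2) %/ 3))%N.
Proof. by move=> gk; have := ltn_ceil (k - g + 2) (isT : (0 < 3)%N); lia. Qed.

Lemma ceil_quarter (k : nat) : (k <= 4 * ((k + 3) %/ 4))%N.
Proof. by have := ltn_ceil (k + 3) (isT : (0 < 4)%N); lia. Qed.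

Lemma alternating_room (k g u b : nat) : (k <= g + 3 * u)%N -> (2 * u <= k)%N ->
  (g <= b)%N -> (2 * (k - 2 * u) - b <= k - u)%N.
Proof. by lia. Qed.

(** * Guarantee for the output on a good mask *)

Section Deterministic.
Variables (R : realType) (rho p e a : R) (n d G : nat) (x m : seq bool).
Hypotheses (rho01 : 0 < rho <= 1) (sx : size x = n) (sm : size m = size x).
Hypotheses (pE : p = rho * n%:R) (dle : d%:R <= p) (dge : p <= d%:R + 1).
(* The gain over 2n/3 is of order e. *)
Hypotheses (eG : e * G%:R = p) (aE : a = rho * e / 40) (a2 : 2 <= a).
Hypothesis G1000 : 1000 <= G%:R :> R.
Let y := mask m x.

Let r0 : 0 < rho. Proof. by case/andP: rho01. Qed.
Let r1 : rho <= 1. Proof. by case/andP: rho01. Qed.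
Let e80 : 80 <= e.
Proof.
rewrite leNgt; apply/negP => e80.
have : 0 < rho * (80 - e) by apply: mulr_gt0; [exact: r0 | lra].
by move: a2 r1; rewrite aE; lra.
Qed.
Let ae : a <= e / 40.
Proof.
have : 0 <= (1 - rho) * e by apply: mulr_ge0; move: r1 e80; lra.
by rewrite aE; lra.
Qed.
Let ep : 1000 * e <= p.
Proof.
have : 0 <= e * (G%:R - 1000) by apply: mulr_ge0; move: G1000 e80; lra.
by move: eG; lra.
Qed.
Let pn : p <= n%:R.
Proof.
have : 0 <= (1 - rho) * n%:R by apply: mulr_ge0 => //; move: r1; lra.
by rewrite pE; lra.
Qed.
Let n0 : (0 < n)%N. Proof. by rewrite -(ltr_nat R); move: e80 ep pn; lra. Qed.
Let d0 : (0 < d)%N. Proof. by rewrite -(ltr_nat R); move: e80 ep dge; lra. Qed.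
Let G0 : (0 < G)%N. Proof. by rewrite -(ltr_nat R); move: G1000; lra. Qed.

Lemma divn_bounds (i j : nat) : (0 < j)%N ->
  (i %/ j)%:R * j%:R <= i%:R :> R /\ i%:R < ((i %/ j)%:R + 1) * j%:R :> R.
Proof.
move=> j0; rewrite -natrM ler_nat leq_trunc_div; split => //.
by rewrite natr1 -natrM ltr_nat {1}(divn_eq i j) mulSn addnC ltn_add2r ltn_pmod.
Qed.

(** Rounding [d] and rounding the quotient cost at most 1 each, and [a] is at least 2. *)
Lemma trace_position (t : nat) : (t <= n)%N ->
  `|(t * d %/ n)%:R - rho * t%:R| <= a.
Proof.
move=> tn; have [h1 h2] := divn_bounds (t * d) n0.
have nR : 0 < n%:R :> R by rewrite ltr0n.
have tR : t%:R <= n%:R :> R by rewrite ler_nat.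
have t0 : 0 <= t%:R :> R by [].
rewrite natrM in h1 h2; rewrite ler_norml; apply/andP; split.
  have : (rho * t%:R - 2) * n%:R <= (t * d %/ n)%:R * n%:R by move: pE dge a2 => ? ? ?; nra.
  by rewrite ler_pM2r //; move: a2; lra.
have : (t * d %/ n)%:R * n%:R <= rho * t%:R * n%:R by move: pE dle a2 => ? ? ?; nra.
by rewrite ler_pM2r //; move: a2; lra.
Qed.

(** In [majority_count] the error 3 a = 3 rho e / 40, divided by 2 rho, is below 2 e / 40. *)
Lemma tail_count (u : nat) : (2 * u <= n)%N -> ~~ deviates rho a (n - 2 * u) x m ->
  u%:R - 2 * e / 40 <= (count_mem (tail_bit n d y u) (drop (n - 2 * u) x))%:R :> R.
Proof.
move=> un dv; have tn : (n - 2 * u <= size x)%N by rewrite sx leq_subr.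
have := majority_count rho01 sm tn dv (trace_position (leq_subr _ _)) erefl.
rewrite -/y -/(tail_bit n d y u) sx natrB // natrM aE.
set c := (count_mem _ _)%:R; move=> h; rewrite -(ler_pM2l r0).
by move: r0 e80 => ? ?; nra.
Qed.

(** The letters in which alternations are counted come from the first [t] letters of the source: rho
    t is at least about p / 3, well above p / 4. *)
Lemma front_le_trace (t : nat) : (t <= n)%N -> n%:R - 4 <= 3 * t%:R :> R ->
  ~~ deviates rho a t x m -> (d %/ 4 <= size (mask (take t m) (take t x)))%N.
Proof.
move=> tn tlb dv; have tx : (t <= size x)%N by rewrite sx.
have [h _] := deviatesN sm tx dv; move: h; rewrite ler_norml => /andP[h _].
have [h4 _] := divn_bounds d (isT : (0 < 4)%N).
rewrite -(ler_nat R).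
have : p - 4 <= 3 * (rho * t%:R) by rewrite pE; move: r0 r1 => ? ?; nra.
by move: ae e80 ep dle; lra.
Qed.

(** The match has about n - u letters, with u close to (n - g) / 3 and g = d / G at least e - 2.
    This exceeds 2 n / 3 by about e / 3, of which errors in the tail cost only e / 20. *)
Lemma many_alts_case : many_alts G d y ->
  let u := ((n - d %/ G + 2) %/ 3)%N in
  ~~ deviates rho a (n - 2 * u) x m ->
  exists2 k, common_subseq (mkseq (reconstruct G n d y) n) x k
    & 2 / 3 * n%:R + e / 20 <= k%:R.
Proof.
move=> dn u dv.
have [g1 g2] := divn_bounds d G0.
have [u1 u2] := divn_bounds (n - d %/ G + 2) (isT : (0 < 3)%N).
have dGn : (d %/ G <= n)%N.
  rewrite -(ler_nat R); have : 0 <= (d %/ G)%:R :> R by [].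
  by move: G1000 dle pn; nra.
rewrite -/u in u1 u2; rewrite natrD natrB // in u1 u2.
have gl : e - 2 <= (d %/ G)%:R.
  have GR : 0 < G%:R :> R by rewrite ltr0n.
  rewrite -(ler_pM2r GR); move: eG G1000 dge => ? ? ?; nra.
have un : (2 * u <= n)%N.
  by rewrite -(ler_nat R) natrM; move: ep e80 pn; lra.
set t := (n - 2 * u)%N in dv.
have tR : t%:R = n%:R - 2 * u%:R :> R by rewrite natrB // natrM.
have tn : (t <= n)%N by rewrite leq_subr.
have hN : (d %/ 4 <= size (mask (take t m) (take t x)))%N.
  apply: front_le_trace => //; rewrite tR; have : 0 <= (d %/ G)%:R :> R by []; lra.
have hy : (d %/ 4 <= size y)%N.
  by rewrite /y (mask_take_drop t sm) size_cat (leq_trans hN) // leq_addr.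
have alt_t : (d %/ G <= alts (take t x))%N.
  move: dn; rewrite /many_alts front_alts_take // => /leq_trans; apply.
  apply: alts_subseq; rewrite /y (prefix_mask_take sm hN).
  exact: subseq_trans (take_subseq _ _) (mask_subseq _ _).
have lb := tail_count un dv.
(* There is no stretched part here: zero blocks, and [w] = 0. *)
exists (0 * count_blocks (stretchable_block n d 0) 0 0 m x + (t - 0) +
       minn u (count_mem (tail_bit n d y u) (drop t x)))%N.
  have -> : reconstruct G n d y = outbit n d y u 0 (tail_bit n d y u).
    by rewrite /reconstruct /tail_len /front_len dn.
  apply: common_subseq_outbit => //.
    by rewrite !take0 /= /stretch_pos mul0n add0n divn_small // prednK.
  rewrite !subn0 drop0 -/t.
  exact: alternating_room (ceil_third dGn) un alt_t.
rewrite mul0n add0n subn0 natrD tR.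
have : u%:R - 2 * e / 40 <= (minn u (count_mem (tail_bit n d y u) (drop t x)))%:R :> R.
  by rewrite /minn; case: ifP => _ //; move: e80; lra.
by move: e80; lra.
Qed.

Variables (L : R) (B J q : nat).
Hypotheses (B100 : 100 <= B%:R :> R) (rB : rho * B%:R <= L) (LG : 1000 * L <= G%:R).
Hypotheses (JB1 : (J * B)%:R <= 24 / 100 * n%:R :> R).
Hypotheses (JB2 : 23 / 100 * n%:R <= (J * B)%:R :> R).
Hypotheses (q1 : q%:R <= 90 / 100 * B%:R :> R) (q2 : 89 / 100 * B%:R <= q%:R :> R).

(** The stretched blocks give 0.18 n, the alternating and the constant part about n / 4 each. The
    total, about 0.68 n, exceeds 2 n / 3 by a constant fraction of n. *)
Lemma few_alts_case : ~~ many_alts G d y ->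
  forall u : nat, u = ((n + 3) %/ 4)%N ->
  ~~ deviates rho a (n - 2 * u) x m -> ~~ deviates rho a (J * B) x m ->
  (10 * count_blocks (atypical_block rho) B J m x < J)%N ->
  exists2 k, common_subseq (mkseq (reconstruct G n d y) n) x k
    & 2 / 3 * n%:R + e / 20 <= k%:R.
Proof.
move=> dn u uE dv dvJ bad.
have [g1 g2] := divn_bounds d G0.
have [h1 h2] := divn_bounds d (isT : (0 < 4)%N).
have [u1 u2] := divn_bounds (n + 3) (isT : (0 < 4)%N).
have nbig : 1000 <= n%:R :> R by move: e80 ep pn; lra.
rewrite -uE natrD in u1 u2.
have u3n : (3 * u <= n)%N by rewrite -(ler_nat R) natrM; lra.
have n4u : (n <= 4 * u)%N.
  by rewrite uE; exact: ceil_quarter.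
have un : (2 * u <= n)%N by rewrite (leq_trans _ u3n) // leq_mul2r orbT.
have JBn : (J * B <= n)%N by rewrite -(ler_nat R); move: JB1; lra.
have JBu : (J * B <= u)%N by move: n4u JB1; rewrite -!(ler_nat R) (natrM _ 4 u); lra.
have n4uR : n%:R <= 4 * u%:R :> R by rewrite -natrM ler_nat.
set t := (n - 2 * u)%N in dv.
have tR : t%:R = n%:R - 2 * u%:R :> R by rewrite natrB // natrM.
have tn : (t <= n)%N by rewrite leq_subr.
have hN : (d %/ 4 <= size (mask (take t m) (take t x)))%N.
  by apply: front_le_trace => //; rewrite tR; lra.
have hy : (d %/ 4 <= size y)%N.
  by rewrite /y (mask_take_drop t sm) size_cat (leq_trans hN) // leq_addr.
set S := size (mask (take (J * B) m) (take (J * B) x)).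
(* The blocks cover at most 0.24 n, so their trace stays within the first d / 4 letters, where
   alternations are few. *)
have SR : S%:R <= p / 4 - 2.
  have JBx : (J * B <= size x)%N by rewrite sx.
  have [+ _] := deviatesN sm JBx dvJ; rewrite -/S ler_norml => /andP[_ hS].
  have : rho * (J * B)%:R <= rho * (24 / 100 * n%:R) by rewrite ler_pM2l.
  by move: pE ae ep e80; lra.
have Sh : (S <= d %/ 4)%N.
  by rewrite -ltnS -(ltr_nat R) -natr1; move: dge; lra.
have nonconst : (count_blocks nonconstant_block B J m x < d %/ G)%N.
  apply: (@leq_ltn_trans (front_alts d y)); last by rewrite ltnNge.
  apply: leq_trans (count_nonconstant_le_alts _ _ sm) _.
  rewrite front_alts_take //; apply: alts_subseq.
  have -> : mask (take (J * B) m) (take (J * B) x) = take S y.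
    by rewrite (prefix_mask_take sm (leqnn _)) take_size.
  by rewrite -(take_takel y Sh) take_subseq.
have lb := tail_count un dv.
have cover : (J <= count_blocks nonconstant_block B J m x +
        count_blocks (stretchable_block n d q) B J m x +
        count_blocks (atypical_block rho) B J m x)%N.
  by apply: count_blocks_cover => //; rewrite ?sx // -pE.
set g := count_blocks (stretchable_block n d q) B J m x in cover *.
exists (q * g + (t - u) + minn u (count_mem (tail_bit n d y u) (drop t x)))%N.
  have -> : reconstruct G n d y = outbit n d y u u (tail_bit n d y u).
    by rewrite /reconstruct /tail_len /front_len (negPf dn) -uE.
  apply: common_subseq_outbit => //.
  - by clear -u3n; lia.
  - rewrite -/S /stretch_pos -ltnS ltn_divLR //.
    have : (S * n <= u * d)%N.
      rewrite -(ler_nat R) !natrM.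
      have : S%:R * n%:R <= (d%:R / 4) * n%:R :> R.
        by apply: ler_wpM2r => //; move: dge; lra.
      have : n%:R * d%:R <= 4 * u%:R * d%:R :> R by apply: ler_wpM2r.
      lra.
    by move: d0; clear; lia.
  - by clear -u3n n4u; lia.
(* Fewer than d / G blocks have a nonconstant trace, and fewer than J / 10 are atypical. *)
have gJ : 9 / 10 * J%:R - (d %/ G)%:R <= g%:R :> R.
  have : (9 * J <= 10 * g + 10 * (d %/ G))%N by clear -cover bad nonconst; lia.
  by rewrite -(ler_nat R) natrD !natrM; lra.
(* Nonconstant blocks occupy little of the source: B d / G <= B rho n / G <= L n / G. *)
have Br : B%:R * (d %/ G)%:R <= n%:R / 1000 :> R.
  have GR : 0 < G%:R :> R by rewrite ltr0n; exact: G0.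
  rewrite -(ler_pM2r GR) -mulrA.
  apply: (@le_trans _ _ (B%:R * (rho * n%:R))).
    by apply: ler_wpM2l => //; rewrite -pE; move: dle; lra.
  have : rho * B%:R * n%:R <= G%:R / 1000 * n%:R by apply: ler_wpM2r => //; move: rB LG; lra.
  by lra.
(* The numbers are 0.89 (0.9 * 0.23 - 0.001) > 0.18. *)
have qg : 18 / 100 * n%:R <= q%:R * g%:R :> R.
  apply: (@le_trans _ _ (89 / 100 * B%:R * g%:R)); last first.
    by apply: ler_wpM2r; [exact: ler0n | exact: q2].
  have : B%:R * (9 / 10 * J%:R - (d %/ G)%:R) <= B%:R * g%:R :> R by apply: ler_wpM2l.
  by move: JB2; rewrite natrM; lra.
rewrite !natrD natrM natrB; last by clear -u3n; lia.
rewrite tR.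
have : u%:R - 2 * e / 40 <= (minn u (count_mem (tail_bit n d y u) (drop t x)))%:R :> R.
  by rewrite /minn; case: ifP => _ //; move: e80; lra.
by move: e80 ep pn; lra.
Qed.

End Deterministic.

(** * The program *)

Section Hoare.
Variables (R : realType) (n : nat) (delta : R) (y : seq bool) (B : nat).
Implicit Types (P Q : state -> Prop) (c : cmd) (s : state) (t : nat).

Definition runs P c Q t : Prop :=
  forall s, P s -> exists s' t', [/\ exec n delta y B c s s' t', (t' <= t)%N & Q s'].

Lemma runs_seq Q P P' c1 c2 t1 t2 :
  runs P c1 Q t1 -> runs Q c2 P' t2 -> runs P (Seq c1 c2) P' (t1 + t2).
Proof.
move=> h1 h2 s /h1[s1 [t1' [e1 l1 /h2[s2 [t2' [e2 l2 q]]]]]].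
by exists s2, (t1' + t2')%N; split => //; [exact: exec_Seq e1 e2 | exact: leq_add].
Qed.

Lemma runs_setreg P Q r e :
  (forall s, P s -> (Defs.eval n y s e < B)%N /\
     Q (State (upd (reg s) r (Defs.eval n y s e)) (Defs.mem s))) ->
  runs P (SetReg r e) Q 1.
Proof. by move=> h s /h[h1 h2]; eexists; exists 1; split; [exact: exec_SetReg| |]. Qed.

Lemma runs_setmem P Q a e :
  (forall s, P s -> (Defs.eval n y s e < B)%N /\
     Q (State (reg s) (upd (Defs.mem s) (Defs.eval n y s a) (Defs.eval n y s e)))) ->
  runs P (SetMem a e) Q 1.
Proof. by move=> h s /h[h1 h2]; eexists; exists 1; split; [exact: exec_SetMem| |]. Qed.

Lemma runs_if P Q b c1 c2 t :
  runs (fun s => P s /\ test n delta y s b) c1 Q t ->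
  runs (fun s => P s /\ ~~ test n delta y s b) c2 Q t ->
  runs P (If b c1 c2) Q t.+1.
Proof.
move=> h1 h2 s Ps; have [bs|bs] := boolP (test n delta y s b).
  have [s1 [t1 [e1 l1 q]]] := h1 s (conj Ps bs).
  by exists s1, t1.+1; split => //; exact: exec_IfTrue.
have [s1 [t1 [e1 l1 q]]] := h2 s (conj Ps bs).
by exists s1, t1.+1; split => //; exact: exec_IfFalse.
Qed.

(** The invariant is indexed by the number of completed iterations, and the loop makes exactly [N]
    of them. *)
Lemma runs_while (I : nat -> state -> Prop) (N : nat) b c t :
  (forall i s, (i < N)%N -> I i s -> test n delta y s b) ->
  (forall s, I N s -> ~~ test n delta y s b) ->
  (forall i, (i < N)%N -> runs (I i) c (I i.+1) t) ->
  runs (I 0) (While b c) (I N) (N * t.+1).+1.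
Proof.
move=> hT hF hc.
suff h k i : (i + k = N)%N -> runs (I i) (While b c) (I N) (k * t.+1).+1 by exact: h.
elim: k i => [|k IH] i ik s Is.
  rewrite addn0 in ik; rewrite ik in Is; exists s, 1; split => //.
  by apply: exec_WhileFalse; exact: hF.
have iN : (i < N)%N by rewrite -ik -addSnnS leq_addr.
have [s1 [t1 [e1 l1 I1]]] := hc i iN s Is.
have [|s2 [t2 [e2 l2 q]]] := IH i.+1 _ s1 I1; first by rewrite addSnnS.
exists s2, (t1 + t2).+1; split => //; last by move: l1 l2; rewrite mulSn; clear; lia.
exact: exec_WhileTrue (hT _ _ iN Is) e1 e2.
Qed.

Lemma runs_weaken P P' Q t t' c : (forall s, P s -> P' s) -> (t' <= t)%N ->
  runs P' c Q t' -> runs P c Q t.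
Proof.
move=> pp tt h s /pp /h[s1 [t1 [e1 l1 q]]]; exists s1, t1; split => //.
exact: leq_trans l1 tt.
Qed.

End Hoare.

Definition regs (s : state) : seq nat :=
  [:: reg s 0; reg s 1; reg s 2; reg s 3; reg s 4; reg s 5; reg s 6].

Notation incr r e := (SetReg r (EAdd (EReg r) e)).

(* Register 0 holds d, 1 the loop counter, 2 the number of alternations, 3 and
   4 the lengths of the last and the first part of the output, 5 the bit of
   the last part, and 6 the place where the trace is cut. *)
Definition read_density : cmd :=
  Seq (While (CNot (CDelta (EReg 0) EN)) (incr 0 (EConst 1)))
      (SetReg 0 (ESub EN (EReg 0))).

(** Truncated subtractions in both directions add up to 1 exactly when two consecutive bits
    differ. *)
Definition count_alternations : cmd :=
  While (CLt (EAdd (EReg 1) (EConst 1)) (EDiv (EReg 0) (EConst 4)))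
    (Seq (incr 2 (EAdd (ESub (EIn (EReg 1)) (EIn (EAdd (EReg 1) (EConst 1))))
                       (ESub (EIn (EAdd (EReg 1) (EConst 1))) (EIn (EReg 1)))))
         (incr 1 (EConst 1))).

Definition choose_lengths (G : nat) : cmd :=
  If (CLt (EReg 2) (EDiv (EReg 0) (EConst G)))
    (Seq (SetReg 3 (EDiv (EAdd EN (EConst 3)) (EConst 4)))
         (SetReg 4 (EDiv (EAdd EN (EConst 3)) (EConst 4))))
    (SetReg 3 (EDiv (EAdd (ESub EN (EDiv (EReg 0) (EConst G))) (EConst 2)) (EConst 3))).

Definition choose_bit : cmd :=
  Seq (SetReg 6 (EDiv (EMul (ESub EN (EMul (EConst 2) (EReg 3))) (EReg 0)) EN))
 (Seq (SetReg 1 (EReg 6))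
 (Seq (While (CLt (EReg 1) ELen)
        (Seq (incr 5 (EIn (EReg 1))) (incr 1 (EConst 1))))
      (If (CLt (ESub ELen (EReg 6)) (EMul (EConst 2) (EReg 5)))
        (SetReg 5 (EConst 1)) (SetReg 5 (EConst 0))))).

Definition write_output : cmd :=
  Seq (SetReg 1 (EConst 0))
      (While (CLt (EReg 1) EN)
        (Seq (If (CLt (EReg 1) (EReg 4))
               (SetMem (EReg 1) (EIn (EDiv (EMul (EReg 1) (EReg 0)) EN)))
               (If (CLt (EReg 1) (ESub EN (EReg 3)))
                 (SetMem (EReg 1)
                   (ESub (EReg 1) (EMul (EConst 2) (EDiv (EReg 1) (EConst 2)))))
                 (SetMem (EReg 1) (EReg 5))))
             (incr 1 (EConst 1)))).

Definition program (G : nat) : cmd :=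
  Seq read_density (Seq count_alternations (Seq (choose_lengths G)
    (Seq choose_bit write_output))).

(** [delta] is visible only through comparisons: the first loop stops at the least i with delta n <
    i, which is the floor of delta n plus one. For 0 <= delta <= 1 the result lies below rho n by at
    most one. *)
Definition kept (R : realType) (n : nat) (delta : R) : nat :=
  (n - (Num.truncn (delta * n%:R)).+1)%N.

Lemma alts_from_rcons a b c s :
  alts_from c (rcons (rcons s a) b) = (alts_from c (rcons s a) + (a != b))%N.
Proof. by elim: s c => [|d s IH] c /=; rewrite ?addn0 // IH addnA. Qed.

Lemma alts_mkseqS f i :
  alts (mkseq f i.+2) = (alts (mkseq f i.+1) + (f i != f i.+1))%N.
Proof.
rewrite /mkseq -addn1 iotaD map_cat -addn1 iotaD map_cat !cats1 add0n.
by case: [seq f j | j <- iota 0 i] => [|c s] /=; rewrite ?addn0 // alts_from_rcons.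
Qed.

Lemma alts_le s : (alts s <= (size s).-1)%N.
Proof.
case: s => //= a s; elim: s a => //= b s IH a.
by have := IH b; case: (a != b); lia.
Qed.

Section Correctness.
Variables (R : realType) (n G : nat) (delta : R) (y : seq bool).
Hypotheses (delta01 : 0 < delta < 1) (yn : (size y <= n)%N).
Let d := kept n delta.
Notation runs := (runs n delta y n.+2).

Lemma read_density_runs :
  runs (fun s => regs s = [:: 0; 0; 0; 0; 0; 0; 0]) read_density
       (fun s => regs s = [:: d; 0; 0; 0; 0; 0; 0]) (2 * n.+1 + 2).
Proof.
pose q := Num.truncn (delta * n%:R).
have q0 : 0 <= delta * n%:R by apply: mulr_ge0 => //; case/andP: delta01 => /ltW.
have /andP[q1 q2] := truncn_itv q0.
have qn : (q <= n)%N.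
  rewrite -(ler_nat R); apply: le_trans q1 _; case/andP: delta01 => h1 h2.
  by rewrite -[leRHS]mul1r; apply: ler_wpM2r => //; exact: ltW.
pose I i s := regs s = [:: i; 0; 0; 0; 0; 0; 0].
apply: (@runs_weaken _ _ _ _ _ _ (I 0) _ _ ((q.+1 * 2).+1 + 1)) => //; first by lia.
apply: (@runs_seq _ _ _ _ _ (I q.+1)).
  apply: runs_while => [i s iq|s|i iq].
  - case: s => f mm [r0 _ _ _ _ _ _] /=; rewrite r0 -leNgt.
    by apply: le_trans q1; rewrite ler_nat -ltnS.
  - by case: s => f mm [r0 _ _ _ _ _ _] /=; rewrite r0 negbK.
  apply: runs_setreg => -[f mm] [r0 r1 r2 r3 r4 r5 r6] /=.
  by rewrite r0 addn1; split; [lia | rewrite /I /regs /upd /= r1 r2 r3 r4 r5 r6].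
apply: runs_setreg => -[f mm] [r0 r1 r2 r3 r4 r5 r6] /=.
by rewrite r0; split; [lia | rewrite /regs /upd /= r1 r2 r3 r4 r5 r6].
Qed.

Lemma count_alternations_runs :
  runs (fun s => regs s = [:: d; 0; 0; 0; 0; 0; 0]) count_alternations
       (fun s => regs s = [:: d; (d %/ 4).-1; front_alts d y; 0; 0; 0; 0]) (3 * n + 1).
Proof.
have dn : (d %/ 4 <= n)%N by rewrite (leq_trans (leq_div _ _)) // leq_subr.
pose f i := nth false y i.
pose I i s := regs s = [:: d; i; alts (mkseq f i.+1); 0; 0; 0; 0].
(* If d / 4 = 0 the loop does not run; the predecessor is then 0, and one letter has no
   alternations, like the empty string. *)
have -> : (fun s => regs s = [:: d; (d %/ 4).-1; front_alts d y; 0; 0; 0; 0]) = I (d %/ 4).-1.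
  by rewrite /I /front_alts; case: (d %/ 4)%N.
apply: (@runs_weaken _ _ _ _ _ _ (I 0) _ _ (((d %/ 4).-1 * 3).+1)) => //; first by lia.
apply: runs_while => [i s iq|s|i iq].
- by case: s => g mm [r0 r1 _ _ _ _ _] /=; rewrite r0 r1; lia.
- by case: s => g mm [r0 r1 _ _ _ _ _] /=; rewrite r0 r1; lia.
apply: (@runs_seq _ _ _ _ _
  (fun s => regs s = [:: d; i; alts (mkseq f i.+2); 0; 0; 0; 0]) _ _ _ _ 1 1).
  apply: runs_setreg => -[g mm] [r0 r1 r2 r3 r4 r5 r6] /=.
  have -> : (g 2 + (nth false y (g 1) - nth false y (g 1 + 1) +
     (nth false y (g 1 + 1) - nth false y (g 1))) = alts (mkseq f i.+2))%N.
    by rewrite alts_mkseqS r1 r2 addn1 /f; congr (_ + _)%N; case: (nth _ _ i); case: (nth _ _ i.+1).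
  split; last by rewrite /regs /upd /= r0 r1 r3 r4 r5 r6.
  by have := alts_le (mkseq f i.+2); rewrite size_mkseq; lia.
apply: runs_setreg => -[g mm] [r0 r1 r2 r3 r4 r5 r6] /=.
by rewrite r1 addn1; split; [lia | rewrite /I /regs /upd /= r0 r2 r3 r4 r5 r6].
Qed.

Let u := tail_len G n d y.
Let w := front_len G n d y.

Lemma choose_lengths_runs :
  runs (fun s => regs s = [:: d; (d %/ 4).-1; front_alts d y; 0; 0; 0; 0])
       (choose_lengths G)
       (fun s => regs s = [:: d; (d %/ 4).-1; front_alts d y; u; w; 0; 0]) 3.
Proof.
apply: runs_if.
  apply: (@runs_seq _ _ _ _ _
    (fun s => regs s = [:: d; (d %/ 4).-1; front_alts d y; u; 0; 0; 0] /\
       ~~ many_alts G d y) _ _ _ _ 1 1).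
    apply: runs_setreg => -[g mm] [] [r0 r1 r2 r3 r4 r5 r6] /=.
    rewrite r0 r2 => ds; have nd : ~~ many_alts G d y by rewrite /many_alts -ltnNge.
    split; first by rewrite ltn_divLR //; lia.
    by split => //; rewrite /regs /upd /= r0 r1 r2 r4 r5 r6 /u /tail_len (negPf nd).
  apply: runs_setreg => -[g mm] [] [r0 r1 r2 r3 r4 r5 r6] /= nd.
  split; first by rewrite ltn_divLR //; lia.
  by rewrite /regs /upd /= r0 r1 r2 r3 r5 r6 /w /front_len (negPf nd).
apply: (@runs_weaken _ _ _ _ _ _
  (fun s => regs s = [:: d; (d %/ 4).-1; front_alts d y; 0; 0; 0; 0] /\
     many_alts G d y) _ _ 1) => //.
  move=> -[g mm] [] [r0 r1 r2 r3 r4 r5 r6] /=.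
  by rewrite r0 r2 -leqNgt /regs /= r0 r1 r2 r3 r4 r5 r6.
apply: runs_setreg => -[g mm] [] [r0 r1 r2 r3 r4 r5 r6] dn /=.
rewrite r0; split; first by rewrite ltn_divLR //; move: (d %/ G)%N; clear => g; lia.
by rewrite /regs /upd /= r0 r1 r2 r4 r5 r6 /u /w /tail_len /front_len dn.
Qed.

Let k := ((n - 2 * u) * d %/ n)%N.
Let b := tail_bit n d y u.

Lemma choose_bit_runs :
  runs (fun s => regs s = [:: d; (d %/ 4).-1; front_alts d y; u; w; 0; 0])
       choose_bit
       (fun s => [/\ reg s 0 = d, reg s 3 = u, reg s 4 = w & reg s 5 = b]) (3 * n + 5).
Proof.
(* Only the quotient is written, so the word bound concerns it and not the product. *)
have kn : (k <= n)%N.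
  rewrite /k; case: (posnP n) => [->|n0]; first by rewrite divn0.
  by rewrite -[leqRHS](mulKn _ n0) leq_div2r // leq_mul ?leq_subr.
pose D := drop k y.
have sD : size D = (size y - k)%N by rewrite size_drop.
pose I i s := [/\ reg s 0 = d, reg s 3 = u & reg s 4 = w] /\
  [/\ reg s 1 = (k + i)%N, reg s 5 = count id (take i D) & reg s 6 = k].
apply: (@runs_weaken _ _ _ _ _ _ _ _ _ (1 + (1 + ((size D * 3).+1 + 2)))) => [s Ps||].
  exact: Ps.
  by rewrite sD; clear -yn; lia.
apply: (@runs_seq _ _ _ _ _ (fun s => [/\ reg s 0 = d, reg s 3 = u & reg s 4 = w] /\
  (reg s 5 = 0 /\ reg s 6 = k))).
  apply: runs_setreg => -[g mm] [r0 r1 r2 r3 r4 r5 r6] /=; rewrite /upd /= r0 r3 -/k.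
  by split => //; apply: leq_ltn_trans kn _; rewrite ltnS leqnSn.
apply: (@runs_seq _ _ _ _ _ (I 0)).
  apply: runs_setreg => -[g mm] /= [[r0 r3 r4] [r5 r6]]; simpl in *.
  rewrite r6; split; first by apply: leq_ltn_trans kn _; rewrite ltnS leqnSn.
  by rewrite /I /upd /= take0 addn0.
apply: (@runs_seq _ _ _ _ _ (I (size D))).
  apply: runs_while => [i s iD|s|i iD].
  - by case: s => g mm /= [] [r0 r3 r4] [r1 r5 r6]; simpl in *; rewrite r1 -ltn_subRL -sD.
  - by case: s => g mm /= [] [r0 r3 r4] [r1 r5 r6]; simpl in *; rewrite r1 sD; clear; lia.
  apply: (@runs_seq _ _ _ _ _ (fun s => [/\ reg s 0 = d, reg s 3 = u & reg s 4 = w] /\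
    [/\ reg s 1 = (k + i)%N, reg s 5 = count id (take i.+1 D) & reg s 6 = k]) _ _ _ _ 1 1).
    apply: runs_setreg => -[g mm] /= [] [r0 r3 r4] [r1 r5 r6]; simpl in *.
    have -> : (g 5 + nth false y (g 1) = count id (take i.+1 D))%N.
      by rewrite (take_nth false) // -cats1 count_cat /= addn0 r5 r1 nth_drop.
    split => //; apply: (@leq_ltn_trans (size (take i.+1 D))); first exact: count_size.
    by rewrite size_takel // ; move: iD; rewrite sD; clear -yn; lia.
  apply: runs_setreg => -[g mm] /= [] [r0 r3 r4] [r1 r5 r6]; simpl in *.
  rewrite r1; split; first by move: iD; rewrite sD; clear -yn; lia.
  by rewrite /I /upd /= addn1 addnS.
have bE : b = (size y - k < 2 * count id D)%N by [].
apply: runs_if; apply: runs_setreg => -[g mm] /= [] [] [r0 r3 r4] [r1 r5 r6]; simpl in *;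
  rewrite r5 r6 take_size => h; split => //; rewrite /upd /=; split => //.
  by rewrite bE h.
by rewrite bE (negPf h).
Qed.

Lemma write_output_runs :
  runs (fun s => [/\ reg s 0 = d, reg s 3 = u, reg s 4 = w & reg s 5 = b])
       write_output
       (fun s => forall i, (i < n)%N -> (Defs.mem s i != 0) = reconstruct G n d y i)
       (5 * n + 2).
Proof.
pose J i s := [/\ reg s 0 = d, reg s 3 = u, reg s 4 = w & reg s 5 = b] /\ reg s 1 = i.
pose M i s := forall j, (j < i)%N -> (Defs.mem s j != 0) = reconstruct G n d y j.
apply: (@runs_weaken _ _ _ _ _ _ _ _ _ (1 + (n * 5).+1)) => [s Ps||]; first exact: Ps.
  by clear; lia.
apply: (@runs_seq _ _ _ _ _ (fun s => J 0 s /\ M 0 s)).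
  by apply: runs_setreg => -[g mm] /= [r0 r3 r4 r5]; simpl in *; rewrite /J /M /upd.
suff h : runs (fun s => J 0 s /\ M 0 s)
     (While (CLt (EReg 1) EN)
        (Seq (If (CLt (EReg 1) (EReg 4))
               (SetMem (EReg 1) (EIn (EDiv (EMul (EReg 1) (EReg 0)) EN)))
               (If (CLt (EReg 1) (ESub EN (EReg 3)))
                 (SetMem (EReg 1)
                   (ESub (EReg 1) (EMul (EConst 2) (EDiv (EReg 1) (EConst 2)))))
                 (SetMem (EReg 1) (EReg 5))))
             (incr 1 (EConst 1)))) (fun s => J n s /\ M n s) (n * 5).+1.
  by move=> s /h[s' [t [e l [_ q]]]]; exists s', t.
apply: (@runs_while _ _ _ _ _ (fun i s => J i s /\ M i s)) => [i s iN|s|i iN].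
- by case: s => g mm [] [_ r1] _; simpl in *; rewrite r1.
- by case: s => g mm [] [_ r1] _; simpl in *; rewrite r1 ltnn.
have step g mm v : (v != 0) = reconstruct G n d y i -> M i (State g mm) ->
    M i.+1 (State g (upd mm i v)).
  move=> vE Mi j; rewrite ltnS leq_eqVlt /= /upd => /orP[/eqP ->|ji]; first by rewrite eqxx.
  by rewrite (ltn_eqF ji); exact: Mi.
apply: (@runs_seq _ _ _ _ _ (fun s => J i s /\ M i.+1 s) _ _ _ _ 3 1); last first.
  apply: runs_setreg => -[g mm] /= [[[r0 r3 r4 r5] r1] Mi]; simpl in *; rewrite r1 addn1.
  by split; [clear -iN; lia | split; [rewrite /J /upd /= r0 r3 r4 r5 | exact: Mi]].
apply: runs_if.
  apply: (@runs_weaken _ _ _ _ _ _ _ _ _ 1) => [s Ps||]; [exact: Ps | by [] |].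
  apply: runs_setmem => -[g mm] /= [[[[r0 r3 r4 r5] r1] Mi] iw]; simpl in *.
  rewrite r0 r1; rewrite r1 r4 in iw.
  split; first by case: (nth _ _ _).
  split => //; apply: step => //; rewrite /reconstruct /outbit -/u -/w iw.
  by case: (nth _ _ _).
apply: runs_if.
  apply: runs_setmem => -[g mm] /= [[[[[r0 r3 r4 r5] r1] Mi] iw] iu]; simpl in *.
  rewrite r1; rewrite r1 r4 in iw; rewrite r1 r3 in iu; split; first by clear -iN; lia.
  split => //; apply: step => //; rewrite /reconstruct /outbit -/u -/w (negPf iw) iu.
  by rewrite {1}(divn_eq i 2) [(2 * _)%N]mulnC addKn modn2; case: (odd i).
apply: runs_setmem => -[g mm] /= [[[[[r0 r3 r4 r5] r1] Mi] iw] iu]; simpl in *.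
rewrite r1 r5; rewrite r1 r4 in iw; rewrite r1 r3 in iu; split; first by case: (b).
split => //; apply: step => //; rewrite /reconstruct /outbit -/u -/w (negPf iw) (negPf iu).
by rewrite -/b; case: (b).
Qed.

Lemma program_runs :
  exists s t, [/\ exec n delta y n.+2 (program G) init_state s t, (t <= 20 * n.+1)%N &
    forall i, (i < n)%N -> (Defs.mem s i != 0) = reconstruct G n d y i].
Proof.
have h := runs_seq read_density_runs (runs_seq count_alternations_runs
  (runs_seq choose_lengths_runs (runs_seq choose_bit_runs write_output_runs))).
have [|s [t [e l q]]] := h init_state; first by [].
by exists s, t; split => //; apply: leq_trans l _; clear; lia.
Qed.

End Correctness.

(** * Choice of constants and the final probability bound *)

Lemma mktuple_mkseq (n : nat) (f : nat -> bool) :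
  [tuple f i | i < n] = mkseq f n :> seq bool.
Proof.
apply: (@eq_from_nth _ false); rewrite ?size_mkseq ?size_tuple // => i ilt.
by rewrite nth_mkseq // -[i]/(nat_of_ord (Ordinal ilt)) -tnth_nth tnth_mktuple.
Qed.

Lemma kept_bounds (R : realType) (n : nat) (delta : R) : 0 <= delta ->
  delta <= 1 -> (kept n delta)%:R <= (1 - delta) * n%:R /\
  (1 - delta) * n%:R <= (kept n delta)%:R + 1.
Proof.
move=> d0 d1; rewrite /kept; set q := Num.truncn _.
have nd : 0 <= delta * n%:R by exact: mulr_ge0.
have /andP[] := truncn_itv nd; rewrite -/q => q1; rewrite -natr1 => q2.
have n1 : 0 <= (1 - delta) * n%:R by apply: mulr_ge0 => //; lra.
have [qn|nq] := leqP q.+1 n.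
  by rewrite natrB // -natr1; split; lra.
have -> : (n - q.+1 = 0)%N by apply/eqP; rewrite subn_eq0 ltnW.
split => //; move: nq; rewrite ltnS -(ler_nat R) => nq; lra.
Qed.

(** B = floor(K / rho) + 1 gives K < rho B <= K + 1 = L; [q] is the floor of 0.9 B and [J] that of
    0.24 n / B. Rounding costs at most 0.01 B and 0.01 n, since B >= 100 and n >= 100 B. *)
Lemma block_parameters (R : realType) (rho L : R) (n : nat) : 0 < rho <= 1 ->
  L = 120 * 50 * 100 + 1 -> 100 * L <= rho * n%:R ->
  exists B J q : nat,
    [/\ 100 <= B%:R :> R, 120 <= rho * B%:R / 50 / 100, rho * B%:R <= L,
        q%:R <= 90 / 100 * B%:R :> R & 89 / 100 * B%:R <= q%:R :> R] /\
    [/\ (J * B)%:R <= 24 / 100 * n%:R :> R & 23 / 100 * n%:R <= (J * B)%:R :> R].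
Proof.
move=> /andP[r0 r1]; set K : R := 120 * 50 * 100 => LE Ln.
have K0 : 100 <= K by rewrite /K; lra.
have KE : K = 120 * 50 * 100 by [].
clearbody K.
have kr0 : 0 <= K / rho by apply: divr_ge0; lra.
have /andP[b1 b2] := truncn_itv kr0; set B := (Num.truncn (K / rho)).+1 in b2.
have BE : B%:R = (Num.truncn (K / rho))%:R + 1 :> R by rewrite natr1.
have rB1 : K < rho * B%:R by rewrite mulrC -ltr_pdivrMr.
have rB2 : rho * B%:R <= L.
  rewrite BE mulrDr mulr1 LE; apply: lerD => //.
  by rewrite mulrC -ler_pdivlMr.
have B0 : 0 <= B%:R :> R by [].
have rBB : rho * B%:R <= B%:R by rewrite -[leRHS]mul1r; apply: ler_wpM2r.
have B100 : 100 <= B%:R :> R by lra.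
have q0 : 0 <= 90 / 100 * B%:R :> R by lra.
have /andP[q1 q2] := truncn_itv q0; set q := Num.truncn _ in q1 q2.
have Bp : 0 < B%:R :> R by lra.
have j0 : 0 <= 24 / 100 * n%:R / B%:R :> R by apply: divr_ge0 => //; apply: mulr_ge0 => //; lra.
have /andP[j1 j2] := truncn_itv j0; set J := Num.truncn _ in j1 j2.
exists B, J, q; split; first by split => //; rewrite -natr1 in q2; lra.
rewrite natrM; split; first by rewrite -ler_pdivlMr.
have h : 24 / 100 * n%:R < (J%:R + 1) * B%:R :> R by rewrite natr1 -ltr_pdivrMr.
have : B%:R * 100 <= n%:R :> R.
  rewrite -(ler_pM2l r0); lra.
lra.
Qed.

(** A union bound over four bad events. The exponent E = a^2 / (8 rho n) is of order rho^3 n, and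
    the lower bound on rho^3 n says that E >= 24, which also yields a >= 2. *)
Lemma reconstruct_prob (R : realType) (G n : nat) (delta : R) (x : n.-tuple bool) :
  let rho := 1 - delta in
  0 < delta < 1 -> 1000 * (120 * 50 * 100 + 1) <= G%:R :> R ->
  24 * (8 * 40 ^+ 2 * G%:R ^+ 2) <= rho ^+ 3 * n%:R ->
  1 - expR (- ((2 * (8 * 40 ^+ 2 * G%:R ^+ 2))^-1 * rho ^+ 3 * n%:R)) <=
  del_prob delta x (fun y => (2 / 3 + (20 * G%:R)^-1 * rho) * n%:R <=
    (LCS [tuple reconstruct G n (kept n delta) y i | i < n] x)%:R).
Proof.
move=> rho /andP[dl0 dl1]; set L : R := 120 * 50 * 100 + 1 => LG nbig.
have dl01 : 0 <= delta <= 1 by rewrite !ltW.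
have r0 : 0 < rho by rewrite /rho; lra.
have r1 : rho <= 1 by rewrite /rho; lra.
have rho01 : 0 < rho <= 1 by rewrite r0.
have L1 : 1 <= L by rewrite /L; lra.
have LE : L = 120 * 50 * 100 + 1 by [].
clearbody L.
set d := kept n delta.
have [dle dge] : d%:R <= rho * n%:R /\ rho * n%:R <= d%:R + 1.
  by apply: kept_bounds; lra.
clearbody d.
have Gp : 0 < G%:R :> R by lra.
pose p := rho * n%:R; pose e := p / G%:R; pose a := rho * e / 40.
have eG : e * G%:R = p by rewrite /e divfK // gt_eqF.
set E := rho ^+ 3 * n%:R / (8 * 40 ^+ 2 * G%:R ^+ 2).
have D0 : 0 < 8 * 40 ^+ 2 * G%:R ^+ 2 :> R by rewrite mulr_gt0 // exprn_gt0.
have E24 : 24 <= E by rewrite /E ler_pdivlMr.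
have nR : 0 < n%:R :> R.
  rewrite lt0r ler0n andbT; apply/eqP => n0; move: E24; rewrite /E n0 mulr0 mul0r; lra.
have aE : a ^+ 2 / (8 * rho * n%:R) = E.
  by rewrite /a /e /p /E; field; rewrite !gt_eqF.
have a8 : a = 8 * 40 * G%:R * E / rho.
  by rewrite /a /e /p /E; field; rewrite !gt_eqF.
have a2 : 2 <= a.
  rewrite a8 ler_pdivlMr //.
  have : 1 * 24 <= G%:R * E by apply: ler_pM => //; lra.
  lra.
have G1 : 1000 <= G%:R :> R by lra.
have e80 : 80 <= e.
  have : a * 40 = rho * e by rewrite /a; field.
  have : 80 <= rho * e -> 80 <= e.
    move=> h; apply: le_trans h _.
    rewrite -[leRHS]mul1r; apply: ler_wpM2r => //.
    by rewrite /e /p; apply: divr_ge0 => //; apply: mulr_ge0 => //; exact: ltW.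
  by move=> h h2; apply: h; lra.
have Lp : 100 * L <= p.
  rewrite -eG; apply: le_trans (ler_wpM2r (ltW Gp) e80); lra.
have [B [J [q [[B100 rB1 rB2 q1 q2] [JB1 JB2]]]]] := block_parameters rho01 LE Lp.
clear LE nbig.
(* The tail length depends on the trace, so both possible values enter the union bound. *)
pose u1 := ((n - d %/ G + 2) %/ 3)%N; pose u2 := ((n + 3) %/ 4)%N.
pose D1 m := deviates rho a (n - 2 * u1) x m.
pose D2 m := deviates rho a (n - 2 * u2) x m.
pose D3 m := deviates rho a (J * B) x m.
pose D4 m := (J <= 10 * count_blocks (atypical_block rho) B J m x)%N.
have sx : size x = n by exact: size_tuple.
have good m : size m = n -> ~~ D1 m -> ~~ D2 m -> ~~ D3 m -> ~~ D4 m ->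
  exists2 k, common_subseq (mkseq (reconstruct G n d (mask m x)) n) x k
    & 2 / 3 * n%:R + e / 20 <= k%:R.
  move=> sm d1 d2 d3 d4; have smx : size m = size x by rewrite sx.
  have [dn|dn] := boolP (many_alts G d (mask m x)).
    exact: (@many_alts_case R rho p e a n d G x m).
  have h := @few_alts_case R rho p e a n d G x m rho01 sx smx erefl dle dge eG erefl a2 G1
    L B J q B100 rB2 LG JB1 JB2 q1 q2 dn u2 erefl d2 d3.
  by apply: h; rewrite ltnNge.
(* One minus the number of bad events is at most the indicator of success. *)
apply: (@le_trans _ _ (mask_expect (1 - delta) n (fun m =>
   1 + (-1) * (((D1 m)%:R + (D2 m)%:R) + ((D3 m)%:R + (D4 m)%:R))))); last first.
  apply: mask_expect_le_del_prob dl01 _ => m y sm ym.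
  case: (boolP [|| D1 m, D2 m, D3 m | D4 m]) => [h|].
    apply: (@le_trans _ _ 0); last exact: ler0n.
    rewrite mulN1r subr_le0 -!natrD ler1n.
    by move: h; case: (D1 m); case: (D2 m); case: (D3 m); case: (D4 m).
  move=> /norP[h1 /norP[h2 /norP[h3 h4]]].
  have [k ck kb] := good m sm h1 h2 h3 h4.
  rewrite (negPf h1) (negPf h2) (negPf h3) (negPf h4) !mulr0n !addr0 mulr0 addr0.
  rewrite -[leLHS]mulr1n ler_nat lt0b.
  have -> : (2 / 3 + (20 * G%:R)^-1 * rho) * n%:R = 2 / 3 * n%:R + e / 20.
    by rewrite /e /p; field; rewrite gt_eqF.
  apply: le_trans kb _; rewrite ler_nat; apply: LCS_ge.
  by rewrite mktuple_mkseq; rewrite -ym in ck; exact: ck.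
rewrite mask_expectD mask_expect_cst mask_expectZ !mask_expectD mulN1r lerD2l lerN2 -/rho.
have an : 0 <= a <= 2 * rho * (size x)%:R.
  rewrite sx; apply/andP; split; first by lra.
  have : rho * e <= rho * (80 * n%:R).
    rewrite ler_pM2l // /e ler_pdivrMr // /p.
    have : rho * n%:R <= 1 * n%:R by apply: ler_wpM2r => //.
    have : n%:R * 1 <= n%:R * G%:R :> R by apply: ler_wpM2l => //; lra.
    lra.
  by rewrite /a; lra.
have x0 : (0 < size x)%N by rewrite sx -(ltr_nat R).
have dev t : (t <= n)%N -> mask_expect rho n (fun m => (deviates rho a t x m)%:R) <= 4 * expR (- E).
  by move=> tn; have := deviates_prob rho01 x0 (_ : (t <= size x)%N) an; rewrite sx aE; apply.
have JBn : (J * B <= n)%N by rewrite -(ler_nat R); lra.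
have p1 := dev _ (leq_subr (2 * u1) n); have p2 := dev _ (leq_subr (2 * u2) n).
have p3 := dev _ JBn.
have p4 : mask_expect rho n (fun m => (D4 m)%:R) <= expR (- E).
  apply: le_trans (atypical_blocks_prob rho01 sx JBn rB1) _.
  (* [J] is at least 0.23 p / L while E <= p / (1000 L), so J / 20 >= E. *)
  rewrite ler_expR lerN2 ler_pdivlMr //.
  have h1 : 23 / 100 * p <= J%:R * L.
    apply: (@le_trans _ _ (J%:R * (rho * B%:R))); last by apply: ler_wpM2l.
    have : rho * (23 / 100 * n%:R) <= rho * (J * B)%:R by rewrite ler_pM2l.
    by rewrite natrM /p; lra.
  have h2 : E * L <= p / 1000.
    have : E * G%:R <= p.
      apply: (@le_trans _ _ (rho ^+ 3 * n%:R)).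
        rewrite -[leRHS](@divfK _ (8 * 40 ^+ 2 * G%:R ^+ 2)) ?gt_eqF // -/E.
        apply: ler_wpM2l; first exact: le_trans E24.
        have : 1 * G%:R <= G%:R * G%:R :> R by apply: ler_wpM2r => //; move: G1; clear; lra.
        by rewrite (expr2 G%:R); move: G1; clear; lra.
      rewrite /p exprS -mulrA ler_pM2l // -[leRHS]mul1r; apply: ler_wpM2r => //.
      by apply: exprn_ile1 => //; exact: ltW.
    have : E * (1000 * L) <= E * G%:R by apply: ler_wpM2l => //; exact: le_trans E24.
    by clear; lra.
  have p0 : 0 <= p by rewrite /p; apply: mulr_ge0 => //; exact: ltW.
  have Lpos : 0 < L by lra.
  by rewrite -(ler_pM2r Lpos); lra.
have -> : (2 * (8 * 40 ^+ 2 * G%:R ^+ 2))^-1 * rho ^+ 3 * n%:R = E / 2.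
  by rewrite /E; field; rewrite gt_eqF.
(* Three deviation events of probability at most 4 exp(-E) and one of at most exp(-E) sum to 13
   exp(-E); E >= 24 gives exp(E / 2) >= 13. *)
have e13 : 13 * expR (- E) <= expR (- (E / 2)).
  have -> : - E = - (E / 2) + - (E / 2) by field.
  rewrite expRD mulrA -[leRHS]mul1r; apply: ler_wpM2r; first exact: expR_ge0.
  rewrite expRN ler_pdivrMr ?expR_gt0 // mul1r.
  by apply: le_trans (expR_ge1Dx (E / 2)); lra.
by rewrite /D1 /D2 /D3; lra.
Qed.

Lemma reconstruct_linear_time (R : realType) (G : nat) :
  linear_time (fun (n : nat) (delta : R) (y : n.-bseq bool) =>
    [tuple reconstruct G n (kept n delta) y i | i < n]).
Proof.
exists (program G), 1, 20 => n delta y d01.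
have [s [t [e l h]]] := program_runs G d01 (size_bseq y).
exists s, t; rewrite expn1; split => //.
by apply: eq_from_tnth => i; rewrite !tnth_mktuple h.
Qed.

Theorem theorem3p3 (R : realType) :
  exists c c' : R, [/\ 0 < c, 0 < c' &
    forall delta : nat -> R,
      (forall n : nat, 0 < delta n < 1) ->
      ((1 - delta n) * n%:R `^ 3^-1) @[n --> \oo] --> +oo ->
      exists A : forall n : nat, R -> n.-bseq bool -> n.-tuple bool,
        linear_time A /\
        \forall n \near \oo, forall x : n.-tuple bool,
          1 - expR (- (c' * (1 - delta n) ^+ 3 * n%:R)) <=
          del_prob (delta n) x
            (fun y => (2 / 3 + c * (1 - delta n)) * n%:R
                      <= (LCS (A n (delta n) y) x)%:R)].
Proof.
(* This is 1000 times the bound on rho B in [block_parameters]; [G] must be at least as large for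
   the case of few alternations. *)
pose L : R := 1000 * (120 * 50 * 100 + 1).
pose G := (Num.truncn L).+1.
have L0 : 0 <= L by rewrite /L; lra.
have LG : L <= G%:R by have /andP[_ /ltW] := truncn_itv L0.
have Gp : 0 < G%:R :> R by rewrite ltr0n.
have D0 : 0 < 8 * 40 ^+ 2 * G%:R ^+ 2 :> R by rewrite mulr_gt0 // exprn_gt0.
exists (20 * G%:R)^-1, (2 * (8 * 40 ^+ 2 * G%:R ^+ 2))^-1; split.
- by rewrite invr_gt0 mulr_gt0.
- by rewrite invr_gt0 mulr_gt0.
move=> delta d01 cvg_rho.
exists (fun n delta y => [tuple reconstruct G n (kept n delta) y i | i < n]).
split; first exact: reconstruct_linear_time.
pose C : R := 24 * (8 * 40 ^+ 2 * G%:R ^+ 2).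
have C1 : 1 <= C.
  have : 1 <= G%:R ^+ 2 :> R by rewrite exprn_ege1 // ler1n.
  by rewrite /C; lra.
(* Once rho n^(1/3) >= C >= 1, its cube rho^3 n is at least C too, which is the threshold in
   [reconstruct_prob]. *)
move/cvgryPge : cvg_rho => /(_ C); apply: filterS => n hn x.
apply: reconstruct_prob => //; rewrite -/C.
have r0 : 0 < 1 - delta n by case/andP: (d01 n); lra.
have -> : n%:R = (n%:R `^ 3^-1) ^+ 3 :> R.
  by rewrite -powR_mulrn ?powR_ge0 // -powRrM mulVf // powRr1.
rewrite -exprMn; apply: (le_trans hn).
rewrite -[leLHS]expr1; apply: ler_weXn2l => //; exact: le_trans C1 hn.
Qed.
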